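(* Let $r\geq 5$ be an integer. Then for all sufficiently large $n$, \[ ex(n,K_r,B_{r,1})=\mathcal{N}(K_{r-2},T_{r-2}(n-2)), \] and, up to isomorphism, $K_2\vee T_{r-2}(n-2)$ is the unique $B_{r,1}$-free graph on $n$ vertices attaining this maximum number of copies of $K_r$.
   Context: For integers $0\le s<r$, $B_{r,s}$ denotes the graph consisting of two copies of $K_r$ that share exactly $s$ vertices. A graph is $F$-free if it contains no subgraph isomorphic to $F$. For graphs $T,F$, $ex(n,T,F)$ denotes the maximum number of copies of $T$ in an $F$-free graph on $n$ vertices, and $\mathcal{N}(T,G)$ denotes the number of copies of $T$ in the graph $G$. $T_r(m)$ denotes the $r$-partite Turán graph on $m$ vertices, i.e. the complete $r$-partite graph on $m$ vertices whose part sizes differ by at most one. The join $G_1\vee G_2$ is the disjoint union of $G_1$ and $G_2$ together with all edges between $V(G_1)$ and $V(G_2)$. *)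

(* Defs.v *)
From HB Require Import structures.
From mathcomp Require Import all_boot.

Set Implicit Arguments.
Unset Strict Implicit.
Unset Printing Implicit Defensive.

(* Finite simple graphs with vertex type V, as sets of two-element sets.      *)
Record sgraph (V : finType) := SGraph {
  edges : {set {set V}};
  edges_card2 : [forall e in edges, #|e| == 2]
}.

HB.instance Definition _ (V : finType) := [isSub for @edges V].
HB.instance Definition _ (V : finType) := [Finite of sgraph V by <:].

Definition adj (V : finType) (G : sgraph V) : rel V :=
  [rel x y | [set x; y] \in edges G].

Definition edges_of_rel (V : finType) (e : rel V) : {set {set V}} :=
  [set d : {set V} |
    [exists x, exists y, [&& x != y, e x y & d == [set x; y]]]].

Lemma edges_of_rel_card2 (V : finType) (e : rel V) :
  [forall d in edges_of_rel e, #|d| == 2].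
Proof.
apply/forall_inP => d; rewrite inE => /existsP[x /existsP[y]].
by case/and3P=> xy _ /eqP->; rewrite cards2 xy.
Qed.

(* The graph joining distinct x and y whenever e x y or e y x.                *)
Definition graph_of_rel (V : finType) (e : rel V) : sgraph V :=
  SGraph (edges_of_rel_card2 e).

Definition isomorphic (U V : finType) (G : sgraph U) (H : sgraph V) : Prop :=
  exists2 f : U -> V, bijective f & forall x y, adj H (f x) (f y) = adj G x y.

(* The not necessarily induced subgraphs (W, E) of G isomorphic to T; W is    *)
(* recorded so that isolated vertices of T are taken into account.            *)
Definition copies (U V : finType) (T : sgraph U) (G : sgraph V) :
    {set {set V} * {set {set V}}} :=
  [set S : {set V} * {set {set V}} | (S.2 \subset edges G) &&
    [exists f : {ffun U -> V},
      [&& injectiveb f, S.1 == f @: [set: U]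
        & S.2 == [set f @: (e : {set U}) | e in edges T]]]].

Definition ncopies (U V : finType) (T : sgraph U) (G : sgraph V) : nat :=
  #|copies T G|.

Definition free (U V : finType) (F : sgraph U) (G : sgraph V) : bool :=
  copies F G == set0.

Definition ex (n : nat) (U W : finType) (T : sgraph U) (F : sgraph W) : nat :=
  \max_(G : sgraph 'I_n | free F G) ncopies T G.

Definition extremal (n : nat) (U W : finType) (T : sgraph U) (F : sgraph W)
    (V : finType) (G : sgraph V) : Prop :=
  [/\ #|V| = n, free F G & ncopies T G = ex n T F].

Definition complete (r : nat) : sgraph 'I_r :=
  graph_of_rel (fun _ _ => true).

(* The two copies of K_r sit on the first r and on the last r vertices, which *)
(* overlap in the s vertices r - s, ..., r - 1; meaningful for s < r.         *)
Definition two_cliques (r s : nat) : sgraph 'I_(2 * r - s) :=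
  graph_of_rel (fun i j : 'I_(2 * r - s) =>
    ((i < r) && (j < r)) || ((r - s <= i) && (r - s <= j))).

(* The parts are the residue classes mod r, so they are balanced; r > 0.      *)
Definition turan (r m : nat) : sgraph 'I_m :=
  graph_of_rel (fun i j : 'I_m => i %% r != j %% r).

Definition join (U V : finType) (G : sgraph U) (H : sgraph V) :
    sgraph (U + V)%type :=
  graph_of_rel (fun a b : U + V =>
    match a, b with
    | inl x, inl y => adj G x y
    | inr x, inr y => adj H x y
    | _, _ => true
    end).

(* Main.v *)
From mathcomp Require Import all_boot ssralg ssrnum ssrint zify.
Require Import Defs.

Set Implicit Arguments.
Unset Strict Implicit.
Unset Printing Implicit Defensive.

(* A graph is B_(r,1)-free iff no two of its r-cliques meet in exactly one    *)
(* vertex. Call a set heavy if the r-cliques through it cannot be pierced     *)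
(* outside it by r vertices. A heavy set meets every r-clique, and every      *)
(* other heavy set, in a number of vertices different from 1. All but         *)
(* O(n^(r-3)) of the r-cliques consist of a heavy pair P together with r - 2  *)
(* vertices x for which P + x is heavy; write ext P for the set of these x.   *)
(* The sets ext P are pairwise disjoint and span K_(r-1)-free graphs, so by   *)
(* AM-GM a graph with as many r-cliques as K_2 v T_(r-2)(n-2) has a heavy     *)
(* pair P with |ext P| >= n - O(1). Each vertex outside P and ext P lies in   *)
(* only O(n^(r-4)) r-cliques through P, while adding it to a colour class of  *)
(* ext P would create of the order of n^(r-3) new ones; hence there is no     *)
(* such vertex, and the theorem of Zykov, with its case of equality, applies  *)
(* to ext P.                                                                  *)

(** * Families without intersections of size one *)

(** Heaviness lets a set stand in for an r-clique whenever an intersection is tested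
    ([heavy_petal]), so heavy sets inherit the ban on meeting in exactly one vertex
    ([heavy_heavy_avoid]). A case analysis inside a single clique ([avoiding_cases]) shows that a
    clique which is not typical contains a set from a short list, whence the count
    [card_atypical_leq].

    Put t = r - 2. The sizes of the sets [ext P] add up to at most n, and [ext P] spans at most
    (|ext P| / t)^t cliques of size t. Reaching the Turan count, about (n / t)^t, therefore forces
    one [ext P] to contain almost all vertices ([large_ext]), and then all vertices outside P
    ([spanning_ext]). From there on every r-clique is P together with a t-clique of the K_(t+1)-free
    rest. Zykov's bound [card_cliques_leq_prod] and the optimality of balanced parts
    [part_prod_leq_turan], each with its case of equality, then determine the graph
    ([extremal_structure]).

    Conversely every r-clique of K_2 v T_t(n-2) contains both vertices of K_2 ([join_clique_pair]),
    so no two r-cliques share exactly one vertex. *)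

Lemma card_bigcup_leq (T I : finType) (P : pred I) (f : I -> {set T}) :
  #|\bigcup_(i | P i) f i| <= \sum_(i | P i) #|f i|.
Proof.
elim/big_ind2: _ => [|a A b B Aa Bb|i _] //; first by rewrite cards0.
exact: leq_trans (leq_card_setU _ _) (leq_add Aa Bb).
Qed.

(** The size bound is asked only of the index that witnesses membership. Parameters can thus range
    over a whole type, junk values included. *)
Lemma card_covered_leq (T I : finType) (f : I -> {set T}) (H : {set T}) m :
    (forall x, x \in H -> exists2 i, x \in f i & #|f i| <= m) ->
  #|H| <= #|I| * m.
Proof.
move=> Hf; have /subset_leq_card : H \subset \bigcup_(i | #|f i| <= m) f i.
  by apply/subsetP => x /Hf[i xfi fim]; apply/bigcupP; exists i.
move=> /leq_trans; apply; apply: leq_trans (card_bigcup_leq _ _) _.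
rewrite -sum_nat_const big_mkcond /=.
by apply: leq_sum => i _; case: ifP.
Qed.

Lemma leq_bin_expn n k : 'C(n, k) <= n ^ k.
Proof.
apply: (@leq_trans (n ^_ k)); first by rewrite -bin_ffact leq_pmulr ?fact_gt0.
elim: k => // k IHk; rewrite ffactnSr expnSr leq_mul ?leq_subr //.
Qed.

Lemma card_supersets_leq (V : finType) (D : {set V}) k :
  #|[set B : {set V} | (D \subset B) && (#|B| == #|D| + k)]| <= #|V| ^ k.
Proof.
apply: leq_trans (leq_bin_expn _ k); rewrite -card_draws.
rewrite -(@card_in_imset _ _ (fun B => B :\: D)).
  apply/subset_leq_card/subsetP => _ /imsetP[B /[!inE]/andP[DB /eqP cB] ->].
  by rewrite cardsD (setIidPr DB) cB addKn.
move=> A B /[!inE] /andP[DA _] /andP[DB _] /= eqAB.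
by rewrite -(setID A D) -(setID B D) eqAB (setIidPr DA) (setIidPr DB).
Qed.

Section AvoidingFamily.

Variables (V : finType) (r : nat) (F : {set {set V}}).
Hypothesis F_card : forall B : {set V}, B \in F -> #|B| = r.
Hypothesis F_avoid :
  forall A B : {set V}, A \in F -> B \in F -> #|A :&: B| != 1.

Definition star (D : {set V}) : {set {set V}} := [set B in F | D \subset B].

Definition heavy (D : {set V}) : bool :=
  [forall S : {set V}, (#|S| <= r) ==>
     [exists B in star D, [disjoint B :\: D & S]]].

(** The way heaviness is used: as far as a set S of at most r vertices can tell, D may be replaced
    by a member of F. *)
Lemma heavy_petal (D S : {set V}) : heavy D -> #|S| <= r ->
  exists B, [/\ B \in F, D \subset B & B :&: S = D :&: S].
Proof.
move=> /forallP/(_ S)/implyP hD /hD/exists_inP[B /[!inE]/andP[BF DB] dBS].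
exists B; split=> //; rewrite -(setID B D) (setIidPr DB) setIUl.
by have /eqP -> : (B :\: D) :&: S == set0; rewrite ?setU0 // setI_eq0.
Qed.

Lemma heavy_avoid (D B : {set V}) : heavy D -> B \in F -> #|D :&: B| != 1.
Proof.
move=> hD BF; have [|A [AF _ <-]] := heavy_petal (S := B) hD; first by rewrite F_card.
exact: F_avoid.
Qed.

Lemma heavy_card (D : {set V}) : heavy D -> #|D| <= r.
Proof.
move=> hD; have [|A [/F_card <- DA _]] := heavy_petal (S := set0) hD;
  rewrite ?cards0 //.
exact: subset_leq_card.
Qed.

(** Replace D by a member of F with the same trace on E, which is possible since E has at most r
    elements; then [heavy_avoid] applies to E. *)
Lemma heavy_heavy_avoid (D E : {set V}) : heavy D -> heavy E -> #|D :&: E| != 1.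
Proof.
move=> hD hE; have [|A [AF _ <-]] := heavy_petal (S := E) hD; first exact: heavy_card.
by rewrite setIC heavy_avoid.
Qed.

Lemma heavy1F v : heavy [set v] = false.
Proof.
apply/negP => hv; have [|A [AF vA _]] := heavy_petal (S := set0) hv; rewrite ?cards0 //.
by have := heavy_avoid hv AF; rewrite (setIidPl vA) cards1.
Qed.

Lemma card_star_leq (D : {set V}) k : #|D| + k = r -> #|star D| <= #|V| ^ k.
Proof.
move=> Dk; apply: leq_trans (card_supersets_leq D k).
apply/subset_leq_card/subsetP => B /[!inE]/andP[/F_card -> ->].
by rewrite Dk eqxx.
Qed.

Variable x0 : V.

Definition piercing (D : {set V}) : {set V} :=
  odflt set0 [pick S : {set V} | (#|S| <= r) &&
                [forall B in star D, ~~ [disjoint B :\: D & S]]].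

(** Indexing a fixed piercing set by ['I_r] makes its vertices functions of D and of a bounded
    index, so that they can be counted. The default [x0] and the empty set taken for heavy D are
    harmless: [pierceP] supplies a good index for light D. *)
Definition pierce (D : {set V}) (i : 'I_r) : V := nth x0 (enum (piercing D)) i.

Lemma pierceP (D B : {set V}) : ~~ heavy D -> B \in F -> D \subset B ->
  exists i, pierce D i \in B :\: D.
Proof.
rewrite negb_forall => /existsP[S0]; rewrite negb_imply => /andP[cS0 nS0] BF DB.
rewrite /pierce /piercing; case: pickP => [S /= /andP[cS /forall_inP SP]|/(_ S0)].
  have /SP : B \in star D by rewrite inE BF.
  rewrite -setI_eq0 => /set0Pn[x /setIP[xB xS]].
  have ltx : index x (enum S) < r.
    by apply: leq_trans cS; rewrite cardE index_mem mem_enum.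
  by exists (Ordinal ltx); rewrite nth_index ?mem_enum.
by rewrite cS0 /= -negb_exists_in nS0.
Qed.

(** Every member through a light D contains one of r sets with one more element, which saves a
    factor |V| over [card_star_leq], at the cost of a factor r. *)
Lemma card_star_light (D : {set V}) k : ~~ heavy D -> #|D| + k.+1 = r ->
  #|star D| <= r * #|V| ^ k.
Proof.
move=> lD Dk; rewrite -[r in r * _]card_ord.
apply: (@card_covered_leq _ _
  (fun i => if pierce D i \in D then set0 else star (pierce D i |: D))) => B.
rewrite inE => /andP[BF DB]; have [i /setDP[iB iD]] := pierceP lD BF DB.
exists i; rewrite (negPf iD); first by rewrite inE BF subUset sub1set iB.
by apply: card_star_leq; rewrite cardsU1 iD; lia.
Qed.

(** * Typical and exceptional members of the family *)

Definition link2 v i := pierce [set v] i.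
Definition link3 v i j := pierce [set v; link2 v i] j.
(** Grow {v} by piercing vertices twice. The singleton is always light, and so is the pair if v lies
    in no heavy pair; hence each member through such a v contains one of r^2 triples. *)
Definition trip v i j : {set V} := v |: [set link2 v i; link3 v i j].

Lemma tripP v (B : {set V}) : B \in F -> v \in B ->
    (forall Q : {set V}, heavy Q -> #|Q| = 2 -> v \notin Q) ->
  exists i j, #|trip v i j| = 3 /\ trip v i j \subset B.
Proof.
move=> BF vB vQ; have [||i] := @pierceP [set v] B _ BF.
- by rewrite heavy1F.
- by rewrite sub1set.
rewrite !inE -/(link2 v i) => /andP[iv iB].
have [||j] := @pierceP [set v; link2 v i] B _ BF.
- apply: contraL isT => /vQ; rewrite cards2 eq_sym iv => /(_ erefl).
  by rewrite !inE eqxx.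
- by rewrite subUset !sub1set vB iB.
rewrite !inE negb_or -/(link3 v i j) => /andP[/andP[jv ji] jB].
exists i, j; rewrite /trip !subUset !sub1set vB iB jB cardsU1 cards2 !inE.
by rewrite negb_or eq_sym iv eq_sym jv eq_sym ji.
Qed.

(** The heavy pair through v, unique by [heavy_pair_uniq] and empty if there is none. One vertex
    determines both, so choosing a heavy pair costs a factor n only. *)
Definition mates v : {set V} :=
  odflt set0 [pick Q : {set V} | [&& heavy Q, #|Q| == 2 & v \in Q]].

Lemma heavy_pair_uniq (P Q : {set V}) x : heavy P -> #|P| = 2 -> heavy Q -> #|Q| = 2 ->
  x \in P -> x \in Q -> P = Q.
Proof.
move=> hP P2 hQ Q2 xP xQ; have := heavy_heavy_avoid hP hQ.
have : 0 < #|P :&: Q| by apply/card_gt0P; exists x; rewrite inE xP.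
have : #|P :&: Q| <= 2 by rewrite -P2 subset_leq_card ?subsetIl.
move=> le2 gt0 ne1; have eq2 : #|P :&: Q| = 2 by lia.
have /eqP <- : P :&: Q == P by rewrite eqEcard subsetIl P2 eq2.
by apply/eqP; rewrite eqEcard subsetIr Q2 eq2.
Qed.

Lemma matesE (P : {set V}) x : heavy P -> #|P| = 2 -> x \in P -> mates x = P.
Proof.
move=> hP P2 xP; rewrite /mates; case: pickP => [Q /= /and3P[hQ /eqP Q2 xQ]|/(_ P)].
  exact: heavy_pair_uniq xQ xP.
by rewrite hP P2 xP eqxx.
Qed.

(* Each of the next four conditions puts into B a set chosen in O(n^k) ways   *)
(* and contained in only O(n^(r - 3 - k)) members of F, for some k.           *)
Definition light_trip (B : {set V}) :=
  [exists v, exists i, exists j, [&& trip v i j \subset B, #|trip v i j| == 3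
     & ~~ heavy (trip v i j)]].

Definition light_quad (B : {set V}) :=
  [exists v, exists i, exists j, exists z,
     [&& z |: trip v i j \subset B, #|z |: trip v i j| == 4
       & ~~ heavy (z |: trip v i j)]].

Definition pierced_trip (B : {set V}) :=
  [exists v, exists i, exists j, exists k,
     let D := pierce [set link2 v i; link3 v i j] k |: trip v i j in
     (D \subset B) && (#|D| == 4)].

Definition three_mates (B : {set V}) :=
  [exists a, exists b, exists c,
     let D := mates a :|: mates b :|: mates c in (D \subset B) && (#|D| == 6)].

Definition typical (B : {set V}) :=
  [exists P : {set V}, [&& P \subset B, heavy P, #|P| == 2
     & [forall x in B :\: P, heavy (x |: P)]]].

(** Suppose B escapes the four exceptional classes, and call a vertex paired if it lies in a heavy
    pair. If B contains a heavy pair P and an unpaired vertex, then P is the pair required by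
    [typical]. If all vertices of B are paired, B contains three disjoint heavy pairs. If B contains
    no heavy pair, the heavy triples at its vertices share a light pair, and piercing that pair is
    contradictory. *)
Lemma avoiding_cases (B : {set V}) : 5 <= r -> B \in F ->
  [|| light_trip B, light_quad B, pierced_trip B, three_mates B | typical B].
Proof.
move=> r5 BF.
case: (boolP (light_trip B)) => //= nlt; case: (boolP (light_quad B)) => //= nlq.
case: (boolP (pierced_trip B)) => //= npt; case: (boolP (three_mates B)) => //= ntm.
pose paired x := [exists Q : {set V}, [&& heavy Q, #|Q| == 2 & x \in Q]].
have pair_sub (Q : {set V}) x : heavy Q -> #|Q| = 2 -> x \in Q -> x \in B -> Q \subset B.
  move=> hQ Q2 xQ xB; have QB := heavy_avoid hQ BF.
  have gt0 : 0 < #|Q :&: B| by apply/card_gt0P; exists x; rewrite inE xQ.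
  have le2 : #|Q :&: B| <= #|Q| by rewrite subset_leq_card ?subsetIl.
  by apply/setIidPl/eqP; rewrite eqEcard subsetIl; lia.
(* T consists of the two links of a triple at the unpaired vertex x; the three conclusions are the
   failures of [light_trip], [light_quad] and [pierced_trip]. *)
have trp x : x \in B -> ~~ paired x -> exists T : {set V},
    [/\ T \subset B, #|T| = 2, x \notin T, heavy (x |: T) &
     (forall z, z \in B -> z \notin x |: T -> heavy (z |: (x |: T))) /\
     (forall k, pierce T k \in B -> pierce T k \in x |: T)].
  move=> xB npx; have [|i [j [t3 tB]]] := tripP BF xB.
    move=> Q hQ Q2; apply: contra npx => xQ; apply/existsP; exists Q.
    by rewrite hQ Q2 xQ eqxx.
  have tE : trip x i j = x |: [set link2 x i; link3 x i j] by [].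
  exists [set link2 x i; link3 x i j].
  set T := [set _; _] in tE *.
  have := t3; rewrite tE cardsU1 => cT.
  have T2 : #|T| <= 2 by rewrite cards2; case: (_ != _).
  split=> //; first by apply: subset_trans tB; rewrite tE subsetUr.
  - apply/eqP; rewrite eqn_leq T2; move: cT; case: (_ \notin _) => [[e]|e].
      by rewrite (e : #|T| = 2).
    by rewrite (e : #|T| = 3).
  - apply/negP => xT; move: cT; rewrite xT => cT.
    by rewrite (cT : #|T| = 3) in T2.
  - apply: contraR nlt => nh; apply/existsP; exists x; apply/existsP; exists i.
    by apply/existsP; exists j; rewrite tB t3 eqxx tE.
  split=> [z zB zT|k kB].
    apply: contraR nlq => nh; apply/existsP; exists x; apply/existsP; exists i.
    apply/existsP; exists j; apply/existsP; exists z.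
    by rewrite subUset sub1set zB tB cardsU1 t3 tE zT nh.
  apply: contraR npt => nk; apply/existsP; exists x; apply/existsP; exists i.
  apply/existsP; exists j; apply/existsP; exists k => /=.
  by rewrite -/T subUset sub1set kB tB cardsU1 t3 tE nk.
(* P cannot miss x + T, for then adding some p in P would give a heavy 4-set meeting P in p alone.
   So P lies in x + T, and it avoids x because x is unpaired. *)
have pair_eq (P : {set V}) x (T : {set V}) : heavy P -> #|P| = 2 -> P \subset B -> x \in B ->
    ~~ paired x -> #|T| = 2 -> heavy (x |: T) ->
    (forall z, z \in B -> z \notin x |: T -> heavy (z |: (x |: T))) -> P = T.
  move=> hP P2 PB xB npx T2 hT hz.
  have xP : x \notin P.
    by apply: contra npx => xP; apply/existsP; exists P; rewrite hP P2 xP eqxx.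
  have ne1 := heavy_heavy_avoid hT hP.
  have [/eqP/setP d0|] := boolP ((x |: T) :&: P == set0).
    have /card_gt0P[p pP] : 0 < #|P| by rewrite P2.
    have pT : p \notin x |: T by have := d0 p; rewrite !inE pP andbT => ->.
    have := heavy_heavy_avoid (hz p (subsetP PB _ pP) pT) hP.
    rewrite setIUl (_ : (x |: T) :&: P = set0) ?setU0; last exact/setP.
    by rewrite (setIidPl _) ?sub1set // cards1.
  rewrite -card_gt0 => gt0.
  have le2 : #|(x |: T) :&: P| <= #|P| by rewrite subset_leq_card ?subsetIr.
  have /setIidPr/subsetP PT : (x |: T) :&: P = P.
    apply/eqP; rewrite eqEcard subsetIr P2; move: ne1 gt0.
    by case: #|_| => [|[]].
  apply/eqP; rewrite eqEcard T2 P2 leqnn andbT; apply/subsetP => y yP.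
  by have := PT y yP; rewrite !inE => /predU1P[yx|//]; rewrite yx (negPf xP) in yP.
have [/existsP[P /and3P[hP /eqP P2 PB]]|noP] :=
    boolP [exists P : {set V}, [&& heavy P, #|P| == 2 & P \subset B]].
  (* One unpaired x forces P = T. A heavy pair through y outside P would also equal T, so every such
     y is unpaired and its own triple is y + P. *)
  have [/exists_inP[x xB npx]|allp] := boolP [exists x in B, ~~ paired x].
    have [T [TB T2 xT hT [hz _]]] := trp x xB npx.
    have PT := pair_eq P x T hP P2 PB xB npx T2 hT hz.
    apply/existsP; exists P; rewrite PB hP P2 eqxx /=; apply/forall_inP => y.
    rewrite inE => /andP[yP yB].
    have npy : ~~ paired y.
      apply/negP => /existsP[Q /and3P[hQ /eqP Q2 yQ]].
      have QT := pair_eq Q x T hQ Q2 (pair_sub _ _ hQ Q2 yQ yB) xB npx T2 hT hz.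
      by rewrite PT -QT yQ in yP.
    have [T' [TB' T2' yT' hT' [hz' _]]] := trp y yB npy.
    by rewrite (pair_eq P y T' hP P2 PB yB npy T2' hT' hz').
  (* Now B is a disjoint union of heavy pairs, and having at least 5 elements it contains three of
     them. *)
  case/negP: ntm; move: allp; rewrite negb_exists_in => /forall_inP allp.
  have matesP x : x \in B ->
      [/\ heavy (mates x), #|mates x| = 2, x \in mates x & mates x \subset B].
    move=> xB; have /negPn/existsP[Q /and3P[hQ /eqP Q2 xQ]] := allp x xB.
    by rewrite (matesE hQ Q2 xQ); split=> //; apply: pair_sub xB.
  have mates_disj x y : x \in B -> y \in B -> y \notin mates x ->
      mates x :&: mates y = set0.
    move=> /matesP[hx x2 xx _] /matesP[hy y2 yy _] yx; apply/setP => z; rewrite !inE.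
    apply/negP => /andP[zx zy]; case/negP: yx.
    by rewrite (heavy_pair_uniq hx x2 hy y2 zx zy).
  have /card_gt0P[a aB] : 0 < #|B| by rewrite F_card // (leq_trans _ r5).
  have [ha a2 aa aS] := matesP a aB.
  have /card_gt0P[b /setDP[bB ba]] : 0 < #|B :\: mates a|.
    by rewrite cardsD (setIidPr aS) a2 F_card // subn_gt0 (leq_trans _ r5).
  have [hb b2 bb bS] := matesP b bB.
  have ab := mates_disj a b aB bB ba.
  have ab4 : #|mates a :|: mates b| = 4 by rewrite cardsU a2 b2 ab cards0.
  have abS : mates a :|: mates b \subset B by rewrite subUset aS.
  have /card_gt0P[c /setDP[cB]] : 0 < #|B :\: (mates a :|: mates b)|.
    by rewrite cardsD (setIidPr abS) ab4 F_card // subn_gt0.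
  have [hc c2 cc cS] := matesP c cB; rewrite inE negb_or => /andP[ca cb].
  apply/existsP; exists a; apply/existsP; exists b; apply/existsP; exists c => /=.
  by rewrite subUset abS cS cardsU ab4 c2 setIUl !mates_disj // setU0 cards0.
have np (Q : {set V}) : heavy Q -> #|Q| = 2 -> Q \subset B -> False.
  move=> hQ Q2 QB; case/negP: noP; apply/existsP; exists Q.
  by rewrite hQ Q2 QB eqxx.
have npx x : x \in B -> ~~ paired x.
  move=> xB; apply/negP => /existsP[Q /and3P[hQ /eqP Q2 xQ]].
  exact: np hQ Q2 (pair_sub _ _ hQ Q2 xQ xB).
(* Were two of the heavy triples disjoint, adding y to the first would give a heavy set meeting the
   second in y alone. *)
have meet x y (T T' : {set V}) : x \in B -> y \in B -> heavy (x |: T) -> heavy (y |: T') ->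
    (forall z, z \in B -> z \notin x |: T -> heavy (z |: (x |: T))) ->
    1 < #|(x |: T) :&: (y |: T')|.
  move=> xB yB hT hT' hz; have ne1 := heavy_heavy_avoid hT hT'.
  suff : 0 < #|(x |: T) :&: (y |: T')| by case: #|_| ne1 => [|[]].
  rewrite card_gt0; apply/negP => /eqP d0.
  have yT : y \notin x |: T.
    by have /setP/(_ y) := d0; rewrite in_setI setU11 andbT in_set0 => ->.
  have := heavy_heavy_avoid (hz y yB yT) hT'.
  by rewrite setIUl d0 setU0 (setIidPl _) ?sub1set ?setU11 // cards1.
have /card_gt0P[x xB] : 0 < #|B| by rewrite F_card // (leq_trans _ r5).
have [T [TB T2 xT hT [hz _]]] := trp x xB (npx x xB).
have xTB : x |: T \subset B by rewrite subUset sub1set xB.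
have /card_gt1P[y [z [/setDP[yB yT] /setDP[zB zT] yz]]] : 1 < #|B :\: (x |: T)|.
  by rewrite cardsD (setIidPr xTB) cardsU1 xT T2 F_card // ltn_subRL.
have [Y [YB Y2 yY hY [hzY pY]]] := trp y yB (npx y yB).
have [Z [ZB Z2 zZ hZ [hzZ pZ]]] := trp z zB (npx z zB).
have sub_of w (D W : {set V}) : w \notin D -> #|W| = 2 ->
    1 < #|D :&: (w |: W)| -> W \subset D.
  move=> wD W2; rewrite setIUr (_ : D :&: [set w] = set0) ?set0U => [gt1|].
    by apply/setIidPr/eqP; rewrite eqEcard subsetIr W2.
  by apply/setP => v; rewrite !inE; case: eqP => [->|]; rewrite ?andbF // (negPf wD).
have YD := sub_of y _ Y yT Y2 (meet _ _ _ _ xB yB hT hY hz).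
have ZD := sub_of z _ Z zT Z2 (meet _ _ _ _ xB zB hT hZ hz).
have zyY : z \notin y |: Y.
  by rewrite !inE eq_sym negb_or yz; apply: contra zT => /(subsetP YD).
have ZY : Z \subset Y.
  apply/subsetP => v vZ; have := sub_of z _ Z zyY Z2 (meet _ _ _ _ yB zB hY hZ hzY).
  move=> /subsetP/(_ v vZ); rewrite !inE => /predU1P[vy|//].
  by rewrite -vy (subsetP ZD) in yT.
have {ZY}eqYZ : Z = Y by apply/eqP; rewrite eqEcard ZY Y2 Z2.
(* The triples at y and z share the pair Y, which is light and hence pierced at some vertex of B
   outside Y. By the last property in [trp] that vertex is both y and z. *)
subst Z; have lY : ~~ heavy Y by apply/negP => hhY; exact: np hhY Y2 YB.
have [k /setDP[kB kY]] := pierceP lY BF YB.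
have := pY k kB; have := pZ k kB; rewrite !inE (negPf kY) !orbF => /eqP -> /eqP zy.
by rewrite zy eqxx in yz.
Qed.

(** Choices times star size, class by class: n r^2 times r n^(r-4), n^2 r^2 times r n^(r-5), n r^3
    times n^(r-4), and n^3 times n^(r-6). *)
Lemma card_atypical_leq : 5 <= r ->
  #|[set B in F | ~~ typical B]| <= (3 * r ^ 3 + 1) * #|V| ^ (r - 3).
Proof.
move=> r5; set n := #|V|.
have E1 : #|[set B in F | light_trip B]| <= r ^ 3 * n ^ (r - 3).
  have -> : r ^ 3 * n ^ (r - 3) = #|{: V * 'I_r * 'I_r}| * (r * n ^ (r - 4)).
    rewrite !card_prod !card_ord -/n (_ : r - 3 = (r - 4).+1); last lia.
    by rewrite !expnS; lia.
  apply: (@card_covered_leq _ _ (fun vij => star (trip vij.1.1 vij.1.2 vij.2))).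
  move=> B /[!inE]/andP[BF /existsP[v /existsP[i /existsP[j /and3P[tB /eqP t3 lt]]]]].
  exists (v, i, j) => /=; first by rewrite inE BF.
  by apply: card_star_light lt _; rewrite t3; lia.
have E2 : #|[set B in F | light_quad B]| <= r ^ 3 * n ^ (r - 3).
  have -> : r ^ 3 * n ^ (r - 3) = #|{: V * 'I_r * 'I_r * V}| * (r * n ^ (r - 5)).
    rewrite !card_prod !card_ord -/n (_ : r - 3 = (r - 5).+2); last lia.
    by rewrite !expnS; lia.
  apply: (@card_covered_leq _ _
    (fun p => star (p.2 |: trip p.1.1.1 p.1.1.2 p.1.2))).
  move=> B /[!inE]/andP[BF /existsP[v /existsP[i /existsP[j /existsP[z]]]]].
  move=> /and3P[tB /eqP t3 lt]; exists (v, i, j, z) => /=; first by rewrite inE BF.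
  by apply: card_star_light lt _; rewrite t3; lia.
have E3 : #|[set B in F | pierced_trip B]| <= r ^ 3 * n ^ (r - 3).
  have -> : r ^ 3 * n ^ (r - 3) = #|{: V * 'I_r * 'I_r * 'I_r}| * n ^ (r - 4).
    rewrite !card_prod !card_ord -/n (_ : r - 3 = (r - 4).+1); last lia.
    by rewrite !expnS; lia.
  apply: (@card_covered_leq _ _ (fun p =>
    star (pierce [set link2 p.1.1.1 p.1.1.2; link3 p.1.1.1 p.1.1.2 p.1.2] p.2
          |: trip p.1.1.1 p.1.1.2 p.1.2))).
  move=> B /[!inE]/andP[BF /existsP[v /existsP[i /existsP[j /existsP[k]]]]].
  move=> /andP[tB /eqP t3]; exists (v, i, j, k) => /=; first by rewrite inE BF.
  by apply: card_star_leq; rewrite t3; lia.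
have E4 : #|[set B in F | three_mates B]| <= 1 * n ^ (r - 3).
  (* For r = 5 the exponent r - 6 would be truncated, but then no member can contain six
     vertices. *)
  have [r6|r6] := leqP 6 r; last first.
    rewrite (_ : [set B in F | _] = set0) ?cards0 //.
    apply/setP => B /[!inE]; apply/negP => /andP[/F_card BF].
    move=> /existsP[a /existsP[b /existsP[c /andP[/subset_leq_card]]]].
    by rewrite BF => + /eqP D6; rewrite D6; lia.
  have -> : 1 * n ^ (r - 3) = #|{: V * V * V}| * n ^ (r - 6).
    rewrite !card_prod -/n (_ : r - 3 = (r - 6).+3); last lia.
    by rewrite !expnS; lia.
  apply: (@card_covered_leq _ _ (fun p =>
    star (mates p.1.1 :|: mates p.1.2 :|: mates p.2))).
  move=> B /[!inE]/andP[BF /existsP[a /existsP[b /existsP[c]]]].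
  move=> /andP[tB /eqP t3]; exists (a, b, c) => /=; first by rewrite inE BF.
  by apply: card_star_leq; rewrite t3; lia.
have : [set B in F | ~~ typical B] \subset [set B in F | light_trip B] :|:
    [set B in F | light_quad B] :|: [set B in F | pierced_trip B] :|:
    [set B in F | three_mates B].
  apply/subsetP => B /[!inE]/andP[BF]; have := avoiding_cases r5 BF.
  by move=> + nt; rewrite (negPf nt) orbF BF /= -!orbA.
have U (A B : {set {set V}}) a b : #|A| <= a -> #|B| <= b -> #|A :|: B| <= a + b.
  by move=> Aa Bb; apply: leq_trans (leq_card_setU _ _) (leq_add Aa Bb).
move=> /subset_leq_card/leq_trans; apply.
apply: leq_trans (U _ _ _ _ (U _ _ _ _ (U _ _ _ _ E1 E2) E3) E4) _.
by rewrite mulnDl -mulnA; lia.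
Qed.
End AvoidingFamily.

(** * Zykov's theorem *)

Lemma card_set_sum (T : finType) (M : {set T}) (P : pred T) :
  #|[set x in M | P x]| = \sum_(x in M) P x.
Proof.
rewrite -sum1_card big_mkcond [RHS]big_mkcond; apply: eq_bigr => x _.
by rewrite inE; case: (x \in M); case: (P x).
Qed.

Section Cliques.

Variables (V : finType) (G : sgraph V).
Implicit Types A B W : {set V}.

Lemma adjC x y : adj G x y = adj G y x.
Proof. by rewrite /adj /= setUC. Qed.

Lemma adj_irr x : adj G x x = false.
Proof.
apply/negP => xx; have /forall_inP/(_ _ xx) := edges_card2 G.
by rewrite setUid cards1.
Qed.

Lemma adj_neq x y : adj G x y -> x != y.
Proof. by apply: contraTneq => ->; rewrite adj_irr. Qed.

Definition clique A : bool :=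
  [forall x in A, forall y in A, (x != y) ==> adj G x y].

Lemma cliqueP A : reflect {in A &, forall x y, x != y -> adj G x y} (clique A).
Proof.
apply: (iffP forall_inP) => [h x y xA yA|h x xA].
  by move: (h x xA) => /forall_inP/(_ y yA)/implyP.
by apply/forall_inP => y yA; apply/implyP; apply: h.
Qed.

Lemma cliqueS A B : A \subset B -> clique B -> clique A.
Proof.
by move=> /subsetP AB /cliqueP cB; apply/cliqueP => x y /AB xB /AB; apply: cB.
Qed.

Lemma clique_setU1 x A :
  clique A -> (forall y, y \in A -> y != x -> adj G x y) -> clique (x |: A).
Proof.
move=> /cliqueP cA xA; apply/cliqueP => y z /setU1P[->|yA] /setU1P[->|zA].
- by rewrite eqxx.
- by rewrite eq_sym; apply: xA.
- by rewrite adjC; apply: xA.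
- exact: cA.
Qed.

Definition cliques k W : {set {set V}} :=
  [set A : {set V} | [&& A \subset W, #|A| == k & clique A]].

Lemma cliquesP k W A :
  reflect [/\ A \subset W, #|A| = k & clique A] (A \in cliques k W).
Proof. by rewrite inE; apply: (iffP and3P) => -[? /eqP ? ?]; split=> //; apply/eqP. Qed.

Lemma cliques_at k W x : x \in W ->
  [set A :\ x | A in [set A in cliques k.+1 W | x \in A]]
    = cliques k [set y in W | adj G x y].
Proof.
move=> xW; apply/setP => B; apply/imsetP/cliquesP => [[A /setIdP[]]|[BW Bk cB]].
  move=> /cliquesP[AW Ak /cliqueP cA] xA ->; split.
  - apply/subsetP => y /setD1P[yx yA]; rewrite inE (subsetP AW) //=.
    by apply: cA; rewrite // eq_sym.
  - by move: Ak; rewrite (cardsD1 x) xA => -[].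
  - by apply: cliqueS (subsetDl _ _) _; apply/cliqueP.
have xB : x \notin B by apply/negP => /(subsetP BW); rewrite inE adj_irr andbF.
exists (x |: B); last by rewrite setU1K.
rewrite inE setU11 andbT; apply/cliquesP; split.
- rewrite subUset sub1set xW; apply: subset_trans BW _.
  by apply/subsetP => y /[!inE]/andP[].
- by rewrite cardsU1 xB Bk.
- by apply: clique_setU1 => // y /(subsetP BW) /[!inE]/andP[].
Qed.

Lemma card_cliques_at k W x : x \in W ->
  #|[set A in cliques k.+1 W | x \in A]| = #|cliques k [set y in W | adj G x y]|.
Proof.
move=> xW; rewrite -cliques_at // card_in_imset // => A B /setIdP[_ xA] /setIdP[_ xB].
by move=> eqAB; rewrite -(setD1K xA) -(setD1K xB) eqAB.
Qed.

Definition part (c : V -> nat) W i : {set V} := [set x in W | c x == i].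

Definition multipartite (c : V -> nat) W :=
  {in W &, forall x y, adj G x y = (c x != c y)}.

(** Serves the equality case of Zykov's theorem: a vertex joined to every t-clique of such a W is
    joined to all of W. *)
Lemma transversal_clique (c : V -> nat) t W x :
    (forall y, y \in W -> c y < t) -> multipartite c W ->
    0 < \prod_(i < t) #|part c W i| -> x \in W ->
  exists2 A, A \in cliques t W & x \in A.
Proof.
move=> ct mW prod0 xW.
pose f (i : 'I_t) := if c x == i then x else odflt x [pick y in part c W i].
have fP i : f i \in part c W i.
  rewrite /f; case: eqP => [ci|_]; first by rewrite inE xW ci /=.
  case: pickP => //= no; move: prod0; rewrite (bigD1 i) //=.
  by rewrite (eq_card0 no) mul0n.
have cf i : c (f i) = i by have := fP i; rewrite inE => /andP[_ /eqP].
have fW i : f i \in W by have := fP i; rewrite inE => /andP[].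
exists (f @: [set: 'I_t]).
  apply/cliquesP; split.
  - by apply/subsetP => _ /imsetP[i _ ->].
  - rewrite card_imset ?cardsT ?card_ord // => i j /(congr1 c).
    by rewrite !cf => /val_inj.
  - apply/cliqueP => _ _ /imsetP[i _ ->] /imsetP[j _ ->] ij.
    by rewrite mW // !cf; apply: contra ij => /eqP/val_inj ->.
by apply/imsetP; exists (Ordinal (ct x xW)); rewrite // /f eqxx.
Qed.

(* If v lies in the largest number d of t-cliques, every t-clique meets the   *)
(* non-neighbours of v, so there are at most d times as many t-cliques as     *)
(* non-neighbours; and the d cliques at v correspond to the (t-1)-cliques of  *)
(* its K_t-free neighbourhood.                                                *)
Lemma card_cliques_leq_prod t W : cliques t.+1 W = set0 ->
  exists c : V -> nat,
    [/\ forall x, x \in W -> c x < t,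
        #|cliques t W| <= \prod_(i < t) #|part c W i|
      & #|cliques t W| = \prod_(i < t) #|part c W i| ->
        0 < #|cliques t W| -> multipartite c W].
Proof.
elim: t W => [|t IHt] W noW.
  have W0 : W = set0.
    apply/setP => x; rewrite inE; apply/negP => xW.
    have /setP/(_ [set x]) := noW; rewrite in_set0 => /negP; apply.
    apply/cliquesP; rewrite sub1set cards1; split=> //.
    by apply/cliqueP => y z /set1P -> /set1P ->; rewrite eqxx.
  exists (fun=> 0); rewrite W0; split=> [x||_ _ x]; rewrite ?inE // big_ord0.
  rewrite -(cards1 (set0 : {set V})) subset_leq_card //.
  by apply/subsetP => A /cliquesP[_ /cards0_eq -> _]; rewrite inE.
have [K0|[A0 A0K]] := set_0Vmem (cliques t.+1 W).
  by exists (fun=> 0); rewrite K0 cards0; split.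
pose K := cliques t.+1 W; pose d u := #|[set A in K | u \in A]|.
have /card_gt0P[v0 v0A] : 0 < #|A0| by case/cliquesP: A0K => _ ->.
have v0W : v0 \in W by case/cliquesP: A0K => /subsetP ->.
case: (arg_maxnP d v0W) => v vW dmax.
pose N := [set y in W | adj G v y]; pose M := W :\: N.
have NW : N \subset W by apply/subsetP => y /[!inE]/andP[].
have dE : d v = #|cliques t N| by rewrite /d card_cliques_at.
have noN : cliques t.+1 N = set0.
  apply/eqP; rewrite -cards_eq0 -card_cliques_at // noW.
  by apply/eqP/eq_card0 => A; rewrite !inE.
have [c [ct cle ceq]] := IHt N noN.
pose c' x := if x \in N then c x else t.
have partN (i : 'I_t) : part c' W i = part c N i.
  apply/setP => x; rewrite 2!in_set /c'; case: (boolP (x \in N)) => xN.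
    by rewrite (subsetP NW _ xN).
  by rewrite gtn_eqF ?andbF.
have partM : part c' W t = M.
  apply/setP => x; rewrite in_set in_setD /c' andbC; case: (boolP (x \in N)) => xN.
    by rewrite ltn_eqF // ct.
  by rewrite eqxx.
have prodE : \prod_(i < t.+1) #|part c' W i|
    = (\prod_(i < t) #|part c N i|) * #|M|.
  by rewrite big_ord_recr /= partM; congr (_ * _); apply: eq_bigr => i _; rewrite partN.
have meetM A : A \in K -> 1 <= #|A :&: M|.
  case/cliquesP=> AW Ak cA; rewrite card_gt0; apply/negP => /eqP/setP AM.
  have /setP/(_ A) := noN; rewrite in_set0 => /negP; apply; apply/cliquesP; split=> //.
  apply/subsetP => x xA; have := AM x.
  by rewrite in_setI in_setD in_set0 xA (subsetP AW) // andbT /= => /negbFE.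
have count : \sum_(A in K) #|A :&: M| = \sum_(u in M) d u.
  rewrite /d; under [RHS]eq_bigr do rewrite card_set_sum.
  rewrite exchange_big; apply: eq_bigr => A _ /=; rewrite -card_set_sum.
  by apply: eq_card => u; rewrite in_setI [RHS]in_set andbC.
(* Recorded with [leqif] for the case of equality: every clique of K meets M exactly once, and every
   vertex of M lies in [d v] cliques. *)
have le1 : #|K| <= \sum_(u in M) d u ?= iff [forall (A | A \in K), 1 == #|A :&: M|].
  rewrite -count -sum1_card; apply: leqif_sum => A /meetM.
  by split=> //.
have le2 : \sum_(u in M) d u <= #|M| * d v ?= iff [forall (u | u \in M), d u == d v].
  rewrite -sum_nat_const; apply: leqif_sum => u /setDP[uW _]; split=> //.
  exact: dmax.
have le3 : #|M| * d v <= \prod_(i < t.+1) #|part c' W i|.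
  by rewrite prodE mulnC dE leq_mul.
exists c'; split.
- move=> x xW; rewrite /c'; case: ifP => // /ct; exact: leq_trans.
- by apply: leq_trans le3; apply: leq_trans le1 le2.
move=> eqK K_gt0; rewrite -/K in eqK K_gt0.
have e1 : #|K| = \sum_(u in M) d u.
  by apply/eqP; rewrite eqn_leq le1 (leq_trans le2) // (leq_trans le3) // -eqK.
have e2 : \sum_(u in M) d u = #|M| * d v.
  by apply/eqP; rewrite eqn_leq le2 (leq_trans le3) // -eqK e1.
have e3 : #|M| * d v = \prod_(i < t.+1) #|part c' W i| by rewrite -e2 -e1.
have /forall_inP all1 : [forall (A | A \in K), 1 == #|A :&: M|].
  by rewrite -le1.2 e1.
have /forall_inP alld : [forall (u | u \in M), d u == d v].
  by rewrite -le2.2 e2.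
have /andP[prod0 M0] : (0 < \prod_(i < t) #|part c N i|) && (0 < #|M|).
  by rewrite -muln_gt0 -prodE -eqK.
have eqN : #|cliques t N| = \prod_(i < t) #|part c N i|.
  by move: e3; rewrite prodE mulnC dE => /eqP; rewrite eqn_pmul2r // => /eqP.
have mN : multipartite c N by apply: ceq; rewrite ?eqN.
have MN u x : u \in M -> x \in N -> adj G u x.
  move=> uM xN; have uW : u \in W by case/setDP: uM.
  have [A AN xA] := transversal_clique ct mN prod0 xN.
  (* A clique through u meets M in u only, so the rest of it is a t-clique of N. Since u lies in as
     many cliques as v, all t-cliques of N arise this way. *)
  have /setP/(_ A) : cliques t [set y in W | adj G u y] = cliques t N.
    have cu : #|cliques t [set y in W | adj G u y]| = #|cliques t N|.
      by rewrite -card_cliques_at // -dE; exact/eqP/alld.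
    apply/eqP; rewrite eqEcard cu leqnn andbT.
    rewrite -cliques_at //; apply/subsetP => _ /imsetP[B /setIdP[BK uB] ->].
    have /cliquesP[BW Bk cB] := BK.
    apply/cliquesP; split; last exact: cliqueS (subsetDl _ _) cB.
      apply/subsetP => y /setD1P[yu yB]; apply: contraR yu => yN.
      have /eqP/esym/eqP/cards1P[w /setP Bw] := all1 B BK.
      have := Bw u; have := Bw y.
      rewrite !in_setI !in_setD yB uB yN (subsetP BW _ yB) /= uW !in_set1.
      by case/setDP: uM => _ -> /esym/eqP -> /esym/eqP ->.
    by move: Bk; rewrite (cardsD1 u) uB => -[].
  rewrite AN => /cliquesP[/subsetP/(_ x xA)].
  by rewrite inE => /andP[].
(* An edge inside M together with a t-clique of N would be a clique of the forbidden size t + 2. *)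
have indep u u' : u \in M -> u' \in M -> adj G u u' = false.
  move=> uM uM'; apply/negP => uu'.
  have [A AN] : exists A, A \in cliques t N by apply/card_gt0P; rewrite eqN.
  have /cliquesP[AsN Ak cA] := AN.
  have notA w : w \in M -> w \notin A.
    by case/setDP => _ wN; apply: contra wN => /(subsetP AsN).
  have /setP/(_ (u |: (u' |: A))) := noW; rewrite in_set0 => /negP; apply.
  apply/cliquesP; split.
  - rewrite !subUset !sub1set (subset_trans AsN NW) andbT.
    by case/setDP: uM => ->; case/setDP: uM' => ->.
  - by rewrite !cardsU1 in_setU1 negb_or !notA // Ak adj_neq.
  - apply: clique_setU1.
      by apply: clique_setU1 => // y /(subsetP AsN) yN _; apply: MN.
    by move=> y /setU1P[->//|/(subsetP AsN) yN _]; apply: MN.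
move=> x y xW yW; rewrite /c'.
case: (boolP (x \in N)) => xN; case: (boolP (y \in N)) => yN.
- exact: mN.
- by rewrite adjC MN ?in_setD ?yN // (ltn_eqF (ct x xN)).
- by rewrite MN ?in_setD ?xN // eq_sym (ltn_eqF (ct y yN)).
- by rewrite indep ?eqxx // in_setD ?xN ?yN.
Qed.
End Cliques.

(** * Balanced colourings *)

Definition balanced (V : finType) (c : V -> nat) t (W : {set V}) :=
  forall i j, i < t -> j < t -> #|part c W i| <= #|part c W j|.+1.

Definition part_prod (V : finType) (c : V -> nat) t (W : {set V}) := \prod_(i < t) #|part c W i|.

Definition turan_prod t m := part_prod (fun i : 'I_m => i %% t) t [set: 'I_m].

Lemma sum_ltn_ord t m : \sum_(j < t) (j < m) = minn m t.
Proof.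
elim: t => [|t IHt]; first by rewrite big_ord0 minn0.
by rewrite big_ord_recr IHt /=; case: ltnP; lia.
Qed.

Lemma card_parts (V : finType) (c : V -> nat) t (W : {set V}) :
  (forall x, x \in W -> c x < t) -> \sum_(i < t) #|part c W i| = #|W|.
Proof.
move=> ct; under eq_bigr do rewrite card_set_sum.
rewrite exchange_big -sum1_card; apply: eq_bigr => x xW /=.
by rewrite (bigD1 (Ordinal (ct x xW))) //= eqxx big1 // => i /negPf;
  rewrite eq_sym -val_eqE => ->.
Qed.

(* Sort the colours by decreasing class size and send the k-th vertex of the  *)
(* i-th colour class to k t + i.                                              *)
Lemma balanced_numbering (V : finType) (c : V -> nat) t (W : {set V}) :
    (forall x, x \in W -> c x < t) -> balanced c t W ->
  exists (f : V -> nat) (s : seq nat),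
    [/\ perm_eq s (iota 0 t), {in W &, injective f},
        forall x, x \in W -> f x < #|W|
      & forall x, x \in W -> f x %% t = index (c x) s].
Proof.
move=> ct bal; pose sz i := #|part c W i|.
pose s := sort (fun i j => sz j <= sz i) (iota 0 t).
have ps : perm_eq s (iota 0 t) by rewrite perm_sort.
have ss : size s = t by rewrite size_sort size_iota.
have mem_s i : (i \in s) = (i < t) by rewrite mem_sort mem_iota.
pose k x := index x (enum (part c W (c x))).
have xp x : x \in W -> x \in enum (part c W (c x)).
  by move=> xW; rewrite mem_enum inE xW eqxx.
have idx x : x \in W -> index (c x) s < t.
  by move=> xW; rewrite -[X in _ < X]ss index_mem mem_s ct.
exists (fun x => k x * t + index (c x) s), s; split=> //.
- move=> x y xW yW eqf.
  have tgt0 : 0 < t by apply: leq_trans (ct x xW).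
  have /eqP := congr1 (modn^~ t) eqf.
  rewrite /= !modnMDl !modn_small ?idx // => /eqP eqi.
  have cxy : c x = c y by rewrite -(nth_index 0 (_ : c x \in s)) ?mem_s ?ct // eqi nth_index ?mem_s ?ct.
  move: eqf; rewrite eqi => /eqP; rewrite eqn_add2r eqn_pmul2r // => /eqP.
  rewrite /k cxy => eqk.
  have xp' := xp x xW; rewrite cxy in xp'.
  by rewrite -(nth_index x xp') eqk nth_index // xp.
- move=> x xW; have ix := idx x xW; set i := index (c x) s in ix *.
  have kx : k x < sz (c x) by rewrite /k /sz cardE index_mem xp.
  have -> : #|W| = \sum_(j < t) sz (nth 0 s j).
    rewrite -(card_parts ct) -(big_mkord xpredT sz) /= -[RHS](big_mkord xpredT (fun j => sz (nth 0 s j))).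
    rewrite /index_iota subn0 -(perm_big _ ps) /= (big_nth 0) ss.
    by rewrite /index_iota subn0.
  (* Balance gives every class at least [k x] vertices, and the classes up to position i are no
     smaller than that of x, so they have one more. Summing yields at least [k x * t + i + 1]
     vertices. *)
  have : \sum_(j < t) (k x + (j < i.+1)) <= \sum_(j < t) sz (nth 0 s j).
    apply: leq_sum => j _; have ci : nth 0 s i = c x by rewrite nth_index ?mem_s ?ct.
    case: ltnP => ji; last first.
      rewrite addn0 -ltnS; apply: leq_trans kx _; apply: bal; first exact: ct.
      by rewrite -mem_s mem_nth ?ss.
    rewrite addn1; apply: leq_trans kx _; rewrite -ci.
    apply: (@sorted_leq_nth _ (fun i j => sz j <= sz i)) => //.
    - by move=> a b d ab bd; apply: leq_trans bd ab.
    - by apply: sort_sorted => a b; apply: leq_total.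
    - by rewrite inE ss.
    - by rewrite inE ss.
  rewrite big_split /= sum_nat_const card_ord sum_ltn_ord (minn_idPl ix);
    apply: leq_trans.
  by rewrite mulnC addnS.
- by move=> x xW; rewrite modnMDl modn_small ?idx.
Qed.

(** [balanced_numbering] permutes ['I_m] so that colour classes become residue classes mod t; the
    two products then agree up to the order of factors. *)
Lemma part_prod_balanced m t (c : 'I_m -> nat) :
    (forall x, c x < t) -> balanced c t [set: 'I_m] ->
  part_prod c t [set: 'I_m] = turan_prod t m.
Proof.
move=> ct /balanced_numbering[//|f [s [ps finj fm fs]]].
have fm' x : f x < m by have := fm x; rewrite !inE cardsT card_ord; apply.
pose g x := Ordinal (fm' x).
have ginj : injective g by move=> x y /(congr1 val)/finj; apply; rewrite inE.
have ss : size s = t by rewrite (perm_size ps) size_iota.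
have us : uniq s by rewrite (perm_uniq ps) iota_uniq.
rewrite /part_prod /turan_prod /part_prod -(big_mkord xpredT (fun i => #|part c setT i|)).
rewrite /index_iota subn0 -(perm_big _ ps) /= (big_nth 0) ss big_mkord.
apply: eq_bigr => i _; rewrite -(card_imset _ ginj); congr #|pred_of_set _|.
apply/setP => y; rewrite !inE.
have [g' gK g'K] := injF_bij ginj.
rewrite -[y]g'K (mem_imset _ _ ginj) inE inE /= fs ?inE //.
have cs : c (g' y) \in s by rewrite (perm_mem ps) mem_iota ct.
apply/eqP/eqP => [->|<-]; first by rewrite index_uniq ?ss.
by rewrite nth_index.
Qed.

(** If two classes differed by at least 2, moving a vertex from the larger to the smaller would
    increase the product, the other factors being positive. *)
Lemma max_part_prod_balanced (V : finType) (c : V -> nat) t (W : {set V}) :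
    (forall x, x \in W -> c x < t) -> 0 < part_prod c t W ->
    (forall c' : V -> nat, (forall x, x \in W -> c' x < t) ->
       part_prod c' t W <= part_prod c t W) ->
  balanced c t W.
Proof.
move=> ct c0 cmax i j it jt; rewrite leqNgt; apply/negP => big.
have /card_gt0P[x] : 0 < #|part c W i| by apply: leq_trans big.
rewrite inE => /andP[xW /eqP cx].
have ij : i != j by apply: contraTneq big => ->; rewrite -leqNgt leqW.
pose c' y := if y == x then j else c y.
have c't y : y \in W -> c' y < t by move=> yW; rewrite /c'; case: eqP => // _;
  apply: ct.
have := cmax c' c't; rewrite leqNgt => /negP; apply.
pose oi := Ordinal it; pose oj := Ordinal jt.
have ji' : oj != oi by rewrite -val_eqE /= eq_sym.
have pi : #|part c W i| = #|part c' W i|.+1.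
  rewrite (cardsD1 x) inE xW cx eqxx; congr _.+1; apply: eq_card => y; rewrite !inE /c'.
  by case: (y =P x) => [_|//]; rewrite [j == i]eq_sym (negPf ij) andbF.
have pj : #|part c' W j| = #|part c W j|.+1.
  rewrite (cardsD1 x) inE xW /c' !eqxx; congr _.+1; apply: eq_card => y; rewrite !inE.
  by case: (y =P x) => [->|//]; rewrite cx (negPf ij) andbF.
have split_prod h : part_prod h t W = #|part h W i| *
    (#|part h W j| * \prod_(k < t | (k != oi) && (k != oj)) #|part h W k|).
  by rewrite /part_prod (bigD1 oi) //= (bigD1 oj).
move: c0; rewrite !split_prod pj pi.
have -> : \prod_(k < t | (k != oi) && (k != oj)) #|part c' W k|
    = \prod_(k < t | (k != oi) && (k != oj)) #|part c W k|.
  apply: eq_bigr => k /andP[ki kj]; apply: eq_card => y; rewrite !inE /c'.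
  case: (y =P x) => [->|//]; rewrite cx.
  by rewrite -!val_eqE /= in ki kj; rewrite ![_ == val k]eq_sym (negPf ki) (negPf kj).
rewrite !muln_gt0 !mulnA ltn_mul2r => /and3P[_ _ ->] /=.
by rewrite pi ltnS in big; rewrite mulSn mulnS ltn_add2r.
Qed.

(** Transport c to ['I_m] and compare it with a colouring of maximal product, found among finite
    functions. A positive maximum is attained by a balanced colouring, so it is the Turan product;
    equality makes c itself maximal. *)
Lemma part_prod_leq_turan t (V : finType) (c : V -> nat) (W : {set V}) :
    0 < t -> (forall x, x \in W -> c x < t) ->
  part_prod c t W <= turan_prod t #|W| /\
  (part_prod c t W = turan_prod t #|W| -> 0 < part_prod c t W -> balanced c t W).
Proof.
move=> t0 ct; set m := #|W|.
pose g (k : 'I_m) := c (enum_val k).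
have gt k : g k < t by apply: ct; apply: enum_valP.
have partE i : #|part g setT i| = #|part c W i|.
  rewrite -(card_imset _ enum_val_inj); apply: eq_card => y; apply/imsetP/setIdP.
    by move=> [k + ->]; rewrite !inE /= => ->; split=> //; apply: enum_valP.
  move=> [yW cy]; exists (enum_rank_in yW y); last by rewrite enum_rankK_in.
  by rewrite !inE /g enum_rankK_in.
have prodE : part_prod g t setT = part_prod c t W.
  by apply: eq_bigr => i _; rewrite partE.
pose g0 : {ffun 'I_m -> 'I_t} := [ffun=> Ordinal t0].
pose P (h : {ffun 'I_m -> 'I_t}) := part_prod (fun x => h x : nat) t setT.
have [h _ hmax] := @arg_maxnP _ g0 xpredT P isT.
have hmax' (c' : 'I_m -> nat) : (forall x, c' x < t) -> part_prod c' t setT <= P h.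
  move=> c't; apply: leq_trans (hmax [ffun x => Ordinal (c't x)] isT).
  apply: leq_prod => i _; rewrite leq_eqVlt; apply/orP; left; apply/eqP.
  by apply: eq_card => x; rewrite !inE ffunE.
have hturan : 0 < P h -> P h = turan_prod t m.
  move=> h0; apply: part_prod_balanced => //; apply: max_part_prod_balanced => //.
  by move=> c' c't; apply: hmax' => x; apply: c't.
rewrite -prodE; split.
  have [h0|] := posnP (P h); last by move/hturan <-; apply: hmax'.
  by apply: leq_trans (hmax' g gt) _; rewrite h0.
move=> eqg g0' i j it jt; rewrite -!partE.
apply: max_part_prod_balanced it jt => // c' c't.
rewrite eqg -hturan; first by apply: hmax' => x; apply: c't.
exact: leq_trans g0' (hmax' g gt).
Qed.

Lemma turan_prod_geq t m : (m %/ t) ^ t <= turan_prod t m.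
Proof.
rewrite -[t in _ ^ t]card_ord -prod_nat_const; apply: leq_prod => i _.
have t0 : 0 < t by apply: leq_ltn_trans (ltn_ord i).
have lt (k : 'I_(m %/ t)) : k * t + i < m.
  apply: leq_trans (leq_trunc_div m t); apply: (@leq_trans (k.+1 * t)).
    by rewrite mulSn addnC ltn_add2r.
  by rewrite leq_mul2r (ltn_ord k) orbT.
rewrite -[X in X <= _]card_ord -(card_imset _ (_ : injective (fun k => Ordinal (lt k)))).
  apply/subset_leq_card/subsetP => _ /imsetP[k _ ->].
  by rewrite !inE /= modnMDl modn_small.
move=> k l /(congr1 val)/eqP /=; rewrite eqn_add2r eqn_pmul2r // => /eqP.
exact: val_inj.
Qed.

(** * Copies and cliques *)

Lemma adj_graph_of_rel (V : finType) (e : rel V) x y :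
  adj (graph_of_rel e) x y = (x != y) && (e x y || e y x).
Proof.
rewrite /adj /= inE; apply/existsP/andP => [[u /existsP[v /and3P[uv euv]]]|[xy]].
  rewrite eqEsubset !subUset !sub1set !inE.
  move=> /andP[/andP[/orP[] /eqP -> /orP[] /eqP ->] /andP[]];
  by rewrite ?eqxx ?(negPf uv) ?(eq_sym v u) ?(negPf uv) ?euv ?orbT //.
case/orP => exy; first by exists x; apply/existsP; exists y; rewrite xy exy /=.
by exists y; apply/existsP; exists x; rewrite eq_sym xy exy setUC /=.
Qed.

Lemma adj_complete k i j : adj (complete k) i j = (i != j).
Proof. by rewrite adj_graph_of_rel andbT. Qed.

Lemma adj_turan t m i j : adj (turan t m) i j = (i %% t != j %% t).
Proof.
rewrite adj_graph_of_rel /= (eq_sym (j %% t)) orbb; case: eqP => //= ->.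
by rewrite eqxx.
Qed.

Lemma adj_join (U V : finType) (G : sgraph U) (H : sgraph V) a b :
  adj (join G H) a b =
    match a, b with
    | inl x, inl y => adj G x y
    | inr x, inr y => adj H x y
    | _, _ => true
    end.
Proof.
rewrite adj_graph_of_rel; case: a b => [x|x] [y|y] //=; rewrite [adj _ y x]adjC orbb.
  by case: (boolP (adj G x y)) => [/adj_neq xy|]; rewrite ?andbF // andbT.
by case: (boolP (adj H x y)) => [/adj_neq xy|]; rewrite ?andbF // andbT.
Qed.

Lemma edgeP (V : finType) (G : sgraph V) e :
  reflect (exists x y, [/\ x != y, e = [set x; y] & adj G x y]) (e \in edges G).
Proof.
apply: (equivP idP); split=> [eG|[x [y [_ -> xy]]]]; last exact: xy.
have /forall_inP/(_ _ eG)/cards2P[x [y [xy exy]]] := edges_card2 G.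
by exists x, y; split; rewrite // /adj /= -exy.
Qed.

Lemma embedding_edges (U V : finType) (T : sgraph U) (G : sgraph V) (f : U -> V) :
  reflect (forall x y, adj T x y -> adj G (f x) (f y))
    ([set f @: (e : {set U}) | e in edges T] \subset edges G).
Proof.
apply: (iffP subsetP) => [fG x y xy|fG _ /imsetP[e /edgeP[x [y [_ -> xy]]] ->]].
  rewrite /adj /=; have -> : [set f x; f y] = f @: [set x; y].
    by rewrite imsetU !imset_set1.
  by apply: fG; apply: imset_f.
by rewrite imsetU !imset_set1; apply: fG.
Qed.

Lemma not_freeP (U V : finType) (T : sgraph U) (G : sgraph V) :
  reflect (exists2 f : U -> V, injective f & forall x y, adj T x y -> adj G (f x) (f y))
    (~~ free T G).
Proof.
apply: (iffP (set0Pn _)) => [[S /[!inE]/andP[SG /existsP[f /and3P[/injectiveP fi _ /eqP Sf]]]]|[f fi fG]].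
  by exists f => //; apply/embedding_edges; rewrite -Sf.
exists (f @: [set: U], [set f @: (e : {set U}) | e in edges T]).
rewrite inE /=; apply/andP; split; first exact/embedding_edges.
apply/existsP; exists (finfun f); apply/and3P; split.
- by apply/injectiveP => x y; rewrite !ffunE => /fi.
- by apply/eqP/eq_imset => x; rewrite ffunE.
- apply/eqP; apply: eq_imset => e; apply: eq_imset => x; by rewrite ffunE.
Qed.

(** The edge set of a copy of K_k consists of all pairs of its vertices, so copies correspond to
    cliques. *)
Lemma copies_complete (V : finType) (G : sgraph V) k :
  copies (complete k) G =
    [set (A, [set e : {set V} | (e \subset (A : {set V})) && (#|e| == 2)]) | A in cliques G k setT].
Proof.
apply/setP => -[W E]; rewrite inE /=.
have edgesE (f : {ffun 'I_k -> V}) : injective f ->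
    [set f @: (e : {set 'I_k}) | e in edges (complete k)]
    = [set e : {set V} | (e \subset f @: [set: 'I_k]) && (#|e| == 2)].
  move=> fi; apply/setP => e; rewrite inE; apply/imsetP/andP.
    move=> [d /edgeP[x [y [xy -> _]]] ->]; rewrite imsetU !imset_set1 cards2.
    by rewrite (inj_eq fi) xy subUset !sub1set !imset_f.
  move=> [/subsetP eS /cards2P[u [v [uv ee]]]].
  have /imsetP[x _ ux] : u \in f @: setT by apply: eS; rewrite ee !inE eqxx.
  have /imsetP[y _ vy] : v \in f @: setT by apply: eS; rewrite ee !inE eqxx orbT.
  exists [set x; y]; last by rewrite imsetU !imset_set1 -ux -vy.
  have xy : x != y by apply: contra uv => /eqP xy; rewrite ux vy xy.
  by have := adj_complete x y; rewrite xy.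
apply/andP/imsetP => [[EG /existsP[f /and3P[/injectiveP fi /eqP Wf /eqP Ef]]]|].
  exists W; last by rewrite Ef edgesE // Wf.
  apply/cliquesP; split; first exact: subsetT.
    by rewrite Wf card_imset // cardsT card_ord.
  have /embedding_edges fG : [set f @: (e : {set 'I_k}) | e in edges (complete k)] \subset edges G.
    by rewrite -Ef.
  apply/cliqueP; rewrite Wf => _ _ /imsetP[x _ ->] /imsetP[y _ ->] xy.
  by apply: fG; rewrite adj_complete; apply: contra xy => /eqP ->.
move=> [A /cliquesP[_ Ak /cliqueP cA] [-> ->]].
split.
  apply/subsetP => e /[!inE]/andP[eA /cards2P[x [y [xy ee]]]].
  rewrite ee; apply: cA => //; apply: (subsetP eA); rewrite ee !inE eqxx ?orbT //.
pose f (i : 'I_k) : V := enum_val (cast_ord (esym Ak) i).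
have fE : f @: [set: 'I_k] = A.
  apply/setP => x; apply/imsetP/idP => [[i _ ->]|xA]; first exact: enum_valP.
  by exists (cast_ord Ak (enum_rank_in xA x)); rewrite // /f cast_ordK enum_rankK_in.
have fi : injective (finfun f).
  by move=> i j; rewrite !ffunE => /enum_val_inj/cast_ord_inj.
have fE' : finfun f @: [set: 'I_k] = A.
  by rewrite -[RHS]fE; apply: eq_imset => i; rewrite ffunE.
apply/existsP; exists (finfun f); apply/and3P; split.
- exact/injectiveP.
- by rewrite fE'.
- by rewrite edgesE // fE'.
Qed.

Lemma ncopies_complete (V : finType) (G : sgraph V) k :
  ncopies (complete k) G = #|cliques G k setT|.
Proof. by rewrite /ncopies copies_complete card_imset // => A B []. Qed.

(** * Freeness from B_(r,1) in terms of cliques *)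

Definition avoids_one (V : finType) (G : sgraph V) r :=
  forall A B : {set V}, A \in cliques G r setT -> B \in cliques G r setT -> #|A :&: B| != 1.

Lemma free_two_cliquesP (V : finType) (G : sgraph V) r : 0 < r ->
  free (two_cliques r 1) G <-> avoids_one G r.
Proof.
move=> r0; have adjE (i j : 'I_(2 * r - 1)) : adj (two_cliques r 1) i j =
    (i != j) && (((i < r) && (j < r)) || ((r - 1 <= i) && (r - 1 <= j))).
  by rewrite adj_graph_of_rel; congr (_ && _); lia.
split=> [fG A B /cliquesP[_ Ar cA] /cliquesP[_ Br cB]|avG].
  apply: contraL fG => /cards1P[v ABv].
  have /setIP[vA vB] : v \in A :&: B by rewrite ABv set11.
  (* Here v has position r - 1, the only one common to the first r and the last r positions. *)
  pose s := enum (A :\ v) ++ v :: enum (B :\ v).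
  have sA : size (enum (A :\ v)) = r - 1.
    by rewrite -cardE; move: (cardsD1 v A); rewrite vA Ar; lia.
  have sB : size (enum (B :\ v)) = r - 1.
    by rewrite -cardE; move: (cardsD1 v B); rewrite vB Br; lia.
  have us : uniq s.
    rewrite cat_uniq /= !enum_uniq !mem_enum !setD11 /= andbT.
    apply/hasPn => x; rewrite !mem_enum => /setD1P[xv xB].
    apply/negP => /setD1P[_ xA]; have : x \in A :&: B by rewrite inE xA.
    by rewrite ABv inE (negPf xv).
  have ss : size s = 2 * r - 1 by rewrite size_cat /= sA sB; lia.
  have inA i : i < r -> nth v s i \in A.
    move=> ir; rewrite nth_cat sA; case: ltnP => ir'.
      have : nth v (enum (A :\ v)) i \in enum (A :\ v) by rewrite mem_nth ?sA.
      by rewrite mem_enum => /setD1P[].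
    by rewrite (_ : i - (r - 1) = 0) //; lia.
  have inB i : r - 1 <= i -> i < 2 * r - 1 -> nth v s i \in B.
    move=> ir i2; rewrite nth_cat sA ltnNge ir /=.
    have : nth v (v :: enum (B :\ v)) (i - (r - 1)) \in v :: enum (B :\ v).
      by rewrite mem_nth //= sB; lia.
    by rewrite inE mem_enum => /predU1P[->|/setD1P[]].
  have fi : injective (fun i : 'I_(2 * r - 1) => nth v s i).
    by move=> i j /eqP; rewrite nth_uniq ?ss // => /eqP/val_inj.
  apply/not_freeP; exists (fun i : 'I_(2 * r - 1) => nth v s i) => //.
  move=> i j; rewrite adjE => /andP[ij /orP[] /andP[hi hj]].
    by apply: (cliqueP _ _ cA); rewrite ?inA // (inj_eq fi).
  by apply: (cliqueP _ _ cB); rewrite ?inB // (inj_eq fi).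
apply/negPn/negP => /not_freeP[f fi fG].
pose S : {set 'I_(2 * r - 1)} := [set i : 'I_(2 * r - 1) | i < r].
pose T : {set 'I_(2 * r - 1)} := [set i : 'I_(2 * r - 1) | r - 1 <= i].
have le1 : r <= 2 * r - 1 by lia.
have cS : #|S| = r.
  have wi : injective (widen_ord le1) by move=> i j /(congr1 val) /= /val_inj.
  rewrite -[RHS]card_ord -(card_imset _ wi); apply: eq_card => i; rewrite inE.
  apply/idP/imsetP => [ir|[j _ ->]]; last exact: (ltn_ord j).
  by exists (Ordinal ir) => //; apply: val_inj.
have lt i : i < r -> r - 1 + i < 2 * r - 1 by lia.
have cT : #|T| = r.
  have wi : injective (fun i : 'I_r => Ordinal (lt i (ltn_ord i))).
    by move=> i j /(congr1 val) /= /addnI /val_inj.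
  rewrite -[RHS]card_ord -(card_imset _ wi); apply: eq_card => i; rewrite inE.
  apply/idP/imsetP => [ir|[j _ ->]]; last by rewrite /= leq_addr.
  have ir' : i - (r - 1) < r by have := ltn_ord i; lia.
  by exists (Ordinal ir') => //; apply: val_inj => /=; lia.
have ST1 : #|S :&: T| = 1.
  have r1 : r - 1 < 2 * r - 1 by lia.
  apply/eqP/cards1P; exists (Ordinal r1); apply/setP => i.
  by rewrite !inE -val_eqE /=; lia.
have fq (D : {set 'I_(2 * r - 1)}) : #|f @: D| = #|D| by apply: card_imset.
have := avG (f @: S) (f @: T); rewrite -imsetI; last by move=> x y _ _; apply: fi.
rewrite fq ST1 => h; suff : 1 != 1 by []; apply: h; apply/cliquesP; rewrite fq;
  split=> //.
  apply/cliqueP => _ _ /imsetP[i iS ->] /imsetP[j jS ->] ij.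
  by apply: fG; rewrite adjE -(inj_eq fi) ij; rewrite !inE in iS jS; rewrite iS jS.
apply/cliqueP => _ _ /imsetP[i iS ->] /imsetP[j jS ->] ij.
by apply: fG; rewrite adjE -(inj_eq fi) ij; rewrite !inE in iS jS; rewrite iS jS orbT.
Qed.

(** * Transport along embeddings and isomorphisms *)

Section Embedding.

Variables (U V : finType) (G : sgraph U) (H : sgraph V) (f : U -> V).
Hypothesis f_inj : injective f.
Hypothesis f_adj : forall x y, adj H (f x) (f y) = adj G x y.

Lemma cliques_imset k (W : {set U}) :
  cliques H k (f @: W) = [set f @: (A : {set U}) | A in cliques G k W].
Proof.
have clE (A : {set U}) : clique H (f @: A) = clique G A.
  apply/cliqueP/cliqueP => [cA x y xA yA xy|cA _ _ /imsetP[x xA ->] /imsetP[y yA ->]].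
    by rewrite -f_adj; apply: cA; rewrite ?imset_f ?(inj_eq f_inj).
  by rewrite (inj_eq f_inj) f_adj; apply: cA.
apply/setP => B; apply/cliquesP/imsetP.
  move=> [/subsetP BW]; have -> : B = f @: (f @^-1: B).
    apply/setP => y; apply/idP/imsetP => [yB|[x xB ->]]; last by rewrite inE in xB.
    by have /imsetP[x _ yx] := BW y yB; exists x; rewrite // inE -yx.
  rewrite card_imset // clE => Ak cA; exists (f @^-1: B) => //; apply/cliquesP;
    split=> //.
  by apply/subsetP => x; rewrite inE => /BW; rewrite mem_imset.
by move=> [A /cliquesP[AW Ak cA] ->]; rewrite imsetS ?card_imset ?clE.
Qed.

Lemma card_cliques_imset k (W : {set U}) : #|cliques H k (f @: W)| = #|cliques G k W|.
Proof. by rewrite cliques_imset card_imset //; apply: imset_inj. Qed.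

Lemma avoids_one_imset r : f @: [set: U] = setT -> avoids_one G r -> avoids_one H r.
Proof.
move=> fT avG A B; rewrite -fT cliques_imset => /imsetP[A' A'G ->] /imsetP[B' B'G ->].
by rewrite -imsetI ?card_imset ?avG // => x y _ _; apply: f_inj.
Qed.

End Embedding.

Lemma bij_imsetT (U V : finType) (f : U -> V) : bijective f -> f @: [set: U] = setT.
Proof.
by move=> [g fK gK]; apply/setP => y; rewrite inE -[y]gK imset_f.
Qed.

Lemma isomorphic_cliques (U V : finType) (G : sgraph U) (H : sgraph V) k :
  isomorphic G H -> #|cliques G k setT| = #|cliques H k setT|.
Proof.
by move=> [f bf fG]; rewrite -(bij_imsetT bf) (card_cliques_imset (bij_inj bf) fG).
Qed.

Lemma isomorphic_avoids_one (U V : finType) (G : sgraph U) (H : sgraph V) r :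
  isomorphic G H -> avoids_one G r -> avoids_one H r.
Proof.
by move=> [f bf fG]; apply: (avoids_one_imset (bij_inj bf) fG); apply: bij_imsetT.
Qed.

Lemma isomorphic_ord (V : finType) (G : sgraph V) n :
  #|V| = n -> exists H : sgraph 'I_n, isomorphic G H.
Proof.
move=> <-; exists (graph_of_rel (fun i j => adj G (enum_val i) (enum_val j))).
exists enum_rank; first exact: enum_rank_bij.
move=> x y; rewrite adj_graph_of_rel !enum_rankK [adj G y x]adjC orbb.
by case: (boolP (adj G x y)) => [/adj_neq xy|];
  rewrite ?andbF // andbT (inj_eq enum_rank_inj).
Qed.

Lemma clique_colors (V : finType) (G : sgraph V) (c : V -> nat) k (A : {set V}) :
    (forall x y, adj G x y -> c x != c y) -> (forall x, c x < k) -> clique G A ->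
  #|A| <= k /\ (#|A| = k -> forall i, i < k -> exists2 x, x \in A & c x = i).
Proof.
move=> prop ck /cliqueP cA; pose g x := Ordinal (ck x).
have gi : {in A &, injective g}.
  move=> x y xA yA /(congr1 val) /= /eqP; apply: contraTeq => xy.
  exact: prop (cA x y xA yA xy).
rewrite -(card_in_imset gi); split; first by rewrite -[X in _ <= X]card_ord max_card.
move=> gA i ik; have /eqP gT : g @: A == [set: 'I_k].
  by rewrite eqEcard subsetT cardsT card_ord gA /=.
have /imsetP[x xA xi] : Ordinal ik \in g @: A by rewrite gT inE.
by exists x => //; rewrite -[i]/(val (Ordinal ik)) xi.
Qed.

(** The upper bound is Zykov's; for the lower one, each choice of one vertex from every residue
    class is a clique. *)
Lemma card_cliques_turan t m : 0 < t ->
  #|cliques (turan t m) t setT| = turan_prod t m.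
Proof.
move=> t0; have prop (x y : 'I_m) : adj (turan t m) x y -> x %% t != y %% t.
  by rewrite adj_turan.
have ct (x : 'I_m) : x %% t < t by rewrite ltn_pmod.
have no : cliques (turan t m) t.+1 setT = set0.
  apply/setP => A; rewrite in_set0; apply/negP => /cliquesP[_ At cA].
  by have [] := clique_colors prop ct cA; rewrite At ltnn.
apply/eqP; rewrite eqn_leq; apply/andP; split.
  have [c [ct' cle _]] := card_cliques_leq_prod no; apply: leq_trans cle _.
  by have [] := part_prod_leq_turan t0 ct'; rewrite cardsT card_ord.
pose F (i : 'I_t) : pred 'I_m := mem (part (fun x : 'I_m => x %% t) setT i).
have -> : turan_prod t m = #|(family F : simpl_pred {ffun 'I_t -> 'I_m})|.
  by rewrite card_family foldrE big_image.
have mod_h (h : {ffun 'I_t -> 'I_m}) i : h \in family F -> h i %% t = i.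
  by move=> /familyP/(_ i); rewrite !inE /= => /eqP.
pose im (h : {ffun 'I_t -> 'I_m}) := h @: [set: 'I_t].
rewrite -(@card_in_imset _ _ im).
  apply/subset_leq_card/subsetP => _ /imsetP[h hF ->]; apply/cliquesP; split=> //.
    rewrite card_imset ?cardsT ?card_ord // => i j ij.
    by apply: val_inj; rewrite /= -(mod_h h i) // -(mod_h h j) // ij.
  apply/cliqueP => _ _ /imsetP[i _ ->] /imsetP[j _ ->] ij.
  by rewrite adj_turan !mod_h //; apply: contra ij => /eqP/val_inj ->.
move=> h g hF gF eqim; apply/ffunP => i.
have /imsetP[j _ hj] : h i \in im g by rewrite -eqim imset_f.
by rewrite hj; congr (g _); apply: val_inj; rewrite /= -(mod_h g j) // -hj mod_h.
Qed.

(** * The cliques of K_2 v T_t(m) *)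

Section Join.

Variables (t m : nat).
Hypothesis t_gt0 : 0 < t.
Let J := join (complete 2) (turan t m).
Let a : ('I_2 + 'I_m)%type := inl ord0.
Let b : ('I_2 + 'I_m)%type := inl ord_max.

(** Colour the Turan part by residues and give [a] and [b] the private colours t and t + 1: a clique
    of size t + 2 uses every colour. *)
Lemma join_clique_pair (A : {set _}) : A \in cliques J t.+2 setT -> (a \in A) && (b \in A).
Proof.
move=> /cliquesP[_ Ak cA].
pose c (x : ('I_2 + 'I_m)%type) := match x with inl i => t + i | inr j => j %% t end.
have cp x y : adj J x y -> c x != c y.
  rewrite adj_join; case: x y => [i|i] [j|j] /=.
  - by rewrite adj_complete eqn_add2l.
  - by have := ltn_pmod j t_gt0; lia.
  - by have := ltn_pmod i t_gt0; lia.
  - by rewrite adj_turan.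
have ck x : c x < t.+2.
  case: x => [i|j] /=; first by have := ltn_ord i; lia.
  by have := ltn_pmod j t_gt0; lia.
have [_ /(_ Ak) att] := clique_colors cp ck cA.
apply/andP; split.
  have [|[i|j] xA /= cx] := att t; first by lia.
    by rewrite /a (_ : ord0 = i) //; apply: val_inj => /=; lia.
  by have := ltn_pmod j t_gt0; lia.
have [|[i|j] xA /= cx] := att t.+1; first by lia.
  by rewrite /b (_ : ord_max = i) //; apply: val_inj => /=; lia.
by have := ltn_pmod j t_gt0; lia.
Qed.

Lemma join_avoids_one : avoids_one J t.+2.
Proof.
move=> A B /join_clique_pair/andP[aA bA] /join_clique_pair/andP[aB bB].
apply/negP => /cards1P[x ABx].
have : a \in A :&: B by rewrite inE aA.
have : b \in A :&: B by rewrite inE bA.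
by rewrite ABx !inE => /eqP <- /eqP [].
Qed.

Lemma card_cliques_join : #|cliques J t.+2 setT| = #|cliques (turan t m) t setT|.
Proof.
have -> : cliques J t.+2 setT = [set A in cliques J t.+2 setT | a \in A].
  apply/setP => A; rewrite [RHS]inE; case: (boolP (A \in _)) => //.
  by move=> /join_clique_pair/andP[->].
rewrite card_cliques_at //.
have -> : cliques J t.+1 [set y in setT | adj J a y]
  = [set A in cliques J t.+1 [set y in setT | adj J a y] | b \in A].
  apply/setP => A; rewrite [RHS]inE; case: (boolP (A \in _)) => //.
  rewrite -cliques_at // => /imsetP[B /setIdP[/join_clique_pair/andP[_ bB] _] ->].
  by rewrite !inE bB.
rewrite card_cliques_at; last by rewrite !inE adj_join /a /b adj_complete.
have -> : [set y in [set y in setT | adj J a y] | adj J b y] = inr @: [set: 'I_m].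
  apply/setP => x; rewrite !inE !adj_join; case: x => [i|j] /=.
    rewrite !adj_complete -!val_eqE /=; apply/idP/imsetP => [|[]//].
    by case: i => [[|[|]]].
  by rewrite imset_f.
apply: card_cliques_imset; first by move=> x y [].
by move=> x y; rewrite adj_join.
Qed.

End Join.

(** * The heavy pair of an extremal graph *)

Lemma nat_AGM t (a : 'I_t -> nat) :
  (\prod_(i < t) a i) * t ^ t <= (\sum_(i < t) a i) ^ t.
Proof.
have -> : (\prod_(i < t) a i) * t ^ t = \prod_(i < t) (a i * t).
  by rewrite big_split /= prod_nat_const card_ord.
have [|+ _] := @Num.Theory.leif_AGM_scaled int 'I_t predT (fun i => (a i)%:R%R).
  by move=> i _; rewrite Num.Theory.mulrn_wge0 // Num.Theory.ler0n.
rewrite card_ord -GRing.natr_sum -GRing.natrX.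
under eq_bigr do rewrite -GRing.mulrnA.
by rewrite -GRing.natr_prod Num.Theory.ler_nat.
Qed.

(** Turns the passage from n to n - 2 - t in the Turan count into an error of order n^(t-1). *)
Lemma expn_Bernoulli n b t : n ^ t.+1 <= (n - b) ^ t.+1 + t.+1 * b * n ^ t.
Proof.
elim: t => [|t IHt]; first by rewrite !expn1 expn0; lia.
rewrite expnS; apply: leq_trans (leq_mul (leqnn n) IHt) _.
have nb : n <= (n - b) + b by lia.
have pw : (n - b) ^ t.+1 <= n ^ t.+1 by rewrite leq_exp2r // leq_subr.
have h1 : n * (n - b) ^ t.+1 <= (n - b) ^ t.+2 + b * n ^ t.+1.
  apply: leq_trans (leq_mul nb (leqnn _)) _.
  by rewrite mulnDl -expnS leq_add2l leq_mul2l pw orbT.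
rewrite mulnDr; apply: leq_trans (leq_add h1 (leqnn _)) _.
rewrite -addnA leq_add2l [X in X <= _](_ : _ = t.+2 * b * n ^ t.+1) //.
by rewrite [n ^ t.+1]expnS; lia.
Qed.

Lemma turan_prod_lower t m : 0 < t -> (m - t) ^ t <= turan_prod t m * t ^ t.
Proof.
move=> t0; apply: (@leq_trans ((m %/ t * t) ^ t)).
  rewrite leq_exp2r // leq_subLR {1}(divn_eq m t) addnC leq_add2r.
  by rewrite ltnW // ltn_pmod.
by rewrite expnMn leq_mul2r turan_prod_geq orbT.
Qed.

Section Structure.

(** Writing r = s + 5 turns the exponents r - 3 and r - 4 into s + 2 and s + 1, free of truncated
    subtraction. *)
Variables (s : nat) (V : finType) (G : sgraph V).
Let t := s.+3.
Let r := t.+2.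
Let K := cliques G r setT.
Let n := #|V|.
Hypothesis K_avoid : forall A B : {set V}, A \in K -> B \in K -> #|A :&: B| != 1.

Lemma K_card (B : {set V}) : B \in K -> #|B| = r.
Proof. by case/cliquesP. Qed.

Local Notation hv := (heavy r K).

Definition ext (P : {set V}) : {set V} := [set x | (x \notin P) && hv (x |: P)].

Definition heavy_pairs : {set {set V}} := [set P : {set V} | hv P && (#|P| == 2)].

Lemma heavy_clique (D : {set V}) : hv D -> clique G D.
Proof.
move=> hD; have [|B [/cliquesP[_ _ cB] DB _]] := heavy_petal (S := set0) hD.
  by rewrite cards0.
exact: cliqueS cB.
Qed.

Lemma ext_adj (P : {set V}) x y : x \in P -> y \in ext P -> adj G x y.
Proof.
move=> xP; rewrite inE => /andP[yP /heavy_clique/cliqueP]; apply.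
- by rewrite setU1r.
- by rewrite setU11.
- by apply: contraNneq yP => <-.
Qed.

(** Such a clique plus one vertex p of P would be an r-clique meeting the heavy pair P in p
    alone. *)
Lemma ext_cliques0 P : P \in heavy_pairs -> cliques G t.+1 (ext P) = set0.
Proof.
rewrite inE => /andP[hP /eqP P2]; apply/setP => A; rewrite in_set0; apply/negP.
move=> /cliquesP[/subsetP AX At cA].
have /card_gt0P[p pP] : 0 < #|P| by rewrite P2.
have PA x : x \in A -> x \notin P by move/AX; rewrite inE => /andP[].
have AK : p |: A \in K.
  apply/cliquesP; split; first exact: subsetT.
    by rewrite cardsU1 At (contraL (@PA p) pP).
  by apply: clique_setU1 => // y /AX yX _; apply: ext_adj yX.
have := heavy_avoid K_card K_avoid hP AK.
rewrite setIUr (_ : P :&: A = set0); last first.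
  by apply/setP => x; rewrite !inE andbC; case: (boolP (x \in A)) => // /PA/negPf.
by rewrite setU0 (setIidPr _) ?sub1set // cards1.
Qed.

(** If x is in [ext P], the heavy set x + P cannot meet B in x alone, so B meets P; and B cannot
    meet P in one vertex only. *)
Lemma pair_subset (P B : {set V}) x : P \in heavy_pairs -> B \in K -> x \in P :|: ext P ->
  x \in B -> P \subset B.
Proof.
rewrite inE => /andP[hP /eqP P2] BK xPX xB.
have PB1 := heavy_avoid K_card K_avoid hP BK.
suff gt0 : P :&: B != set0.
  apply/setIidPl/eqP; rewrite eqEcard subsetIl P2.
  by move: gt0 PB1; rewrite -card_gt0; case: #|_| => [|[]].
case/setUP: xPX => [xP|]; first by apply/set0Pn; exists x; rewrite inE xP.
rewrite inE => /andP[xP /heavy_avoid-/(_ K_card K_avoid _ BK)].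
by apply: contra => /eqP PB0; rewrite setIUl PB0 setU0 (setIidPl _) ?sub1set // cards1.
Qed.

(** The heavy sets x + P and x + Q share x, hence another vertex, so the heavy pairs P and Q
    intersect and coincide. *)
Lemma ext_inj (P Q : {set V}) x : P \in heavy_pairs -> Q \in heavy_pairs ->
  x \in ext P -> x \in ext Q -> P = Q.
Proof.
rewrite !inE => /andP[hP /eqP P2] /andP[hQ /eqP Q2] /andP[xP hxP] /andP[xQ hxQ].
have := heavy_heavy_avoid K_card K_avoid hxP hxQ; rewrite -setUIr.
have [->|] := eqVneq (P :&: Q) set0; first by rewrite setU0 cards1.
move=> /set0Pn[y /setIP[yP yQ]] _.
exact: (heavy_pair_uniq K_card K_avoid hP P2 hQ Q2 yP yQ).
Qed.

Lemma sum_ext_leq : \sum_(P in heavy_pairs) #|ext P| <= n.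
Proof.
have card_sum (P : {set V}) : #|ext P| = \sum_(x in setT) (x \in ext P).
  by rewrite -card_set_sum; apply: eq_card => x; rewrite !inE.
under eq_bigr do rewrite card_sum.
rewrite exchange_big /=; apply: (@leq_trans (\sum_(x in [set: V]) 1)); last first.
  by rewrite sum1_card cardsT.
apply: leq_sum => x _.
have [/exists_inP[P PH xP]|no] := boolP [exists P in heavy_pairs, x \in ext P].
  rewrite (bigD1 P) //= xP big1 // => Q /andP[QH QP].
  by case: (boolP (x \in ext Q)) => // xQ; rewrite (ext_inj QH PH xQ xP) eqxx in QP.
rewrite big1 // => P PH; apply/eqP; rewrite eqb0; apply: contra no => xP.
by apply/exists_inP; exists P.
Qed.

Lemma card_ext_cliques P : P \in heavy_pairs ->
  #|cliques G t (ext P)| * t ^ t <= #|ext P| ^ t.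
Proof.
move=> /ext_cliques0/card_cliques_leq_prod[c [ct cle _]].
apply: (@leq_trans ((\prod_(i < t) #|part c (ext P) i|) * t ^ t)).
  by rewrite leq_mul2r cle orbT.
by apply: leq_trans (nat_AGM _) _; rewrite card_parts.
Qed.

Definition pages (P : {set V}) : {set {set V}} :=
  [set B in K | (P \subset B) && (B :\: P \subset ext P)].

Lemma card_pages_leq P : P \in heavy_pairs -> #|pages P| <= #|cliques G t (ext P)|.
Proof.
rewrite inE => /andP[hP /eqP P2].
rewrite -(@card_in_imset _ _ (fun B => B :\: P)).
  apply/subset_leq_card/subsetP => _ /imsetP[B /setIdP[BK /andP[PB BX]] ->].
  apply/cliquesP; rewrite BX cardsD (setIidPr PB) P2 (K_card BK) subn2; split=> //.
  by apply: cliqueS (subsetDl _ _) _; case/cliquesP: BK.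
move=> A B /setIdP[_ /andP[PA _]] /setIdP[_ /andP[PB _]] eqAB.
by rewrite -(setID A P) -(setID B P) eqAB (setIidPr PA) (setIidPr PB).
Qed.

Definition atypical_const := 3 * r ^ 3 + 1.

Lemma card_K_leq : 0 < n ->
  #|K| <= atypical_const * n ^ s.+2 + \sum_(P in heavy_pairs) #|cliques G t (ext P)|.
Proof.
move=> /card_gt0P[x0 _].
have at_leq := @card_atypical_leq V r K K_card K_avoid x0 isT.
have : K \subset [set B in K | ~~ typical r K B] :|: \bigcup_(P in heavy_pairs) pages P.
  apply/subsetP => B BK; rewrite 2!inE BK /=; case: (boolP (typical r K B)) => //=.
  move=> /existsP[P /and4P[PB hP P2 /forall_inP hX]]; apply/bigcupP; exists P.
    by rewrite inE hP.
  rewrite inE BK PB; apply/subsetP => x xBP; rewrite inE hX // andbT.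
  by case/setDP: xBP.
move=> /subset_leq_card/leq_trans; apply; apply: leq_trans (leq_card_setU _ _) _.
apply: leq_add; first exact: at_leq.
apply: leq_trans (card_bigcup_leq _ _) _.
by apply: leq_sum => P; apply: card_pages_leq.
Qed.

Hypothesis K_large : turan_prod t (n - 2) <= #|K|.

(** The first summand pays for the atypical cliques, scaled by t^t, the second for the Bernoulli
    error in [expn_card_K]. *)
Definition gap := t ^ t * atypical_const + t * t.+2.

Lemma expn_card_K : n ^ t <= #|K| * t ^ t + t * t.+2 * n ^ s.+2.
Proof.
apply: leq_trans (expn_Bernoulli n t.+2 s.+2) _; rewrite leq_add2r -/t.
rewrite (_ : n - t.+2 = n - 2 - t); last by lia.
by apply: leq_trans (turan_prod_lower _ _) _; rewrite // leq_mul2r K_large orbT.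
Qed.

(** With x the largest |ext P|, the sum of the |ext P|^t is at most x^(t-1) n, hence at most x
    n^(t-1). So n^t is at most (gap + x) n^(t-1). *)
Lemma large_ext : gap < n ->
  exists2 P, P \in heavy_pairs & n <= gap + #|ext P|.
Proof.
move=> gn; have n0 : 0 < n by apply: leq_ltn_trans gn.
pose x := \max_(P in heavy_pairs) #|ext P|.
suff nx : n <= gap + x.
  have [H0|H0] := posnP #|heavy_pairs|.
    have x0 : x = 0 by rewrite /x big1 // => P; rewrite (card0_eq H0).
    by rewrite x0 addn0 leqNgt gn in nx.
  by have [P PH xP] := @eq_bigmax_cond {set V} (mem heavy_pairs) (fun P => #|ext P|) H0; exists P; rewrite // -xP.
have xn : x <= n by apply/bigmax_leqP => P _; apply: max_card.
have sum_le : (\sum_(P in heavy_pairs) #|cliques G t (ext P)|) * t ^ t <= x ^ s.+2 * n.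
  apply: (@leq_trans (\sum_(P in heavy_pairs) x ^ s.+2 * #|ext P|)).
    rewrite big_distrl /=; apply: leq_sum => P PH.
    apply: leq_trans (card_ext_cliques PH) _; rewrite /t expnSr leq_mul2r leq_exp2r //.
    have -> : #|ext P| <= x by apply: leq_bigmax_cond.
    exact: orbT.
  by rewrite -big_distrr /= leq_mul2l sum_ext_leq orbT.
have x_le : x ^ s.+2 * n <= x * n ^ s.+2.
  rewrite [x ^ s.+2]expnS -mulnA leq_mul2l; apply/orP; right.
  by rewrite [n ^ s.+2]expnSr leq_mul2r leq_exp2r ?xn ?orbT.
have nt : n ^ t = n * n ^ s.+2 by rewrite /t expnS.
have K_le := card_K_leq n0.
have main : n * n ^ s.+2 <= (gap + x) * n ^ s.+2.
  rewrite -nt; apply: leq_trans expn_card_K _.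
  apply: (@leq_trans ((atypical_const * n ^ s.+2 +
     \sum_(P in heavy_pairs) #|cliques G t (ext P)|) * t ^ t + t * t.+2 * n ^ s.+2)).
    by rewrite leq_add2r leq_mul2r K_le orbT.
  have gapE m : gap * m = t ^ t * atypical_const * m + t * t.+2 * m by exact: mulnDl.
  rewrite [(gap + x) * _]mulnDl gapE [(_ + _) * t ^ t]mulnDl addnAC;
    apply: leq_add; last exact: leq_trans sum_le x_le.
  by rewrite leq_add2r mulnAC [_ * t ^ t]mulnC.
by move: main; rewrite leq_pmul2r // expn_gt0 n0.
Qed.

Definition large_const := 2 * (r + 2 ^ gap).

(** Let Y be the rest, y = |Y| and p the product of the colour classes of [ext P]. Giving Y a colour
    shows that the Turan product is at least (1 + y/n) p, while |K| is at most p + y E' with E' =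
    O(n^(t-2)). If y > 0 this yields p <= n E', so |K| is at most [large_const] times n^(t-1), too
    few for large n. *)
Lemma spanning_ext : gap < n -> t ^ t * large_const + t * t.+2 < n ->
  exists2 P, P \in heavy_pairs & ext P = ~: P.
Proof.
move=> gn ln; have [P PH nX] := large_ext gn; exists P => //.
have n0 : 0 < n by apply: leq_ltn_trans gn.
have [hP /eqP P2] : hv P /\ #|P| == 2 by move: PH; rewrite inE => /andP[].
set X := ext P in nX *; pose Y := ~: (P :|: X).
have PX : [disjoint P & X].
  by rewrite -setI_eq0; apply/eqP/setP => x; rewrite !inE; case: (x \in P).
have cPXY : #|P :|: X| + #|Y| = n by rewrite cardsC.
have cPX : #|P :|: X| = 2 + #|X|.
  by rewrite cardsU P2 (disjoint_setI0 PX) cards0 subn0.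
suff Y0 : #|Y| = 0.
  apply/setP => x; rewrite in_setC; have /negbT := card0_eq Y0 x.
  rewrite in_setC negbK in_setU; case: (boolP (x \in P)) => [xP _|_ /= -> //].
  by rewrite (disjointFr PX xP).
apply/eqP; rewrite -leqn0 leqNgt; apply/negP => Y_gt0.
have Yg : #|Y| <= gap by lia.
pose E := r * n ^ s.+1.
(* An r-clique is a page of P, or contains P and some z in Y for which z + P is light, or does not
   contain P and then lies inside Y by [pair_subset]. *)
have K_le : #|K| <= #|cliques G t X| + (#|Y| * E + 2 ^ #|Y|).
  have : K \subset pages P :|: (\bigcup_(z in Y) star K (z |: P) :|: powerset Y).
    apply/subsetP => B BK; rewrite 2!in_setU.
    case: (boolP (P \subset B)) => PB.
      case: (boolP (B :\: P \subset X)) => BX; first by rewrite inE BK PB BX.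
      move/subsetPn: BX => [z /setDP[zB zP] zX].
      apply/orP; right; apply/orP; left; apply/bigcupP; exists z.
        by rewrite in_setC in_setU negb_or zP.
      by rewrite inE BK subUset sub1set zB.
    apply/orP; right; apply/orP; right; rewrite powersetE.
    apply/subsetP => x xB; rewrite in_setC; apply: contra PB => xPX.
    exact: pair_subset PH BK xPX xB.
  move=> /subset_leq_card/leq_trans; apply; apply: leq_trans (leq_card_setU _ _) _.
  apply: leq_add; first exact: card_pages_leq.
  apply: leq_trans (leq_card_setU _ _) _; rewrite card_powerset leq_add2r.
  rewrite -sum_nat_const; apply: leq_trans (card_bigcup_leq _ _) _.
  apply: leq_sum => z; rewrite in_setC in_setU negb_or => /andP[zP zX].
  have /card_gt0P[x0 _] := n0.
  apply: (card_star_light K_card x0).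
    by apply: contra zX => hz; rewrite inE zP.
  by rewrite cardsU1 zP P2.
have [c [ct cle _]] := card_cliques_leq_prod (ext_cliques0 PH).
rewrite -/X in ct cle; pose p := part_prod c t X.
rewrite -[\prod_(i < _) _]/p in cle.
pose c' x := if x \in X then c x else 0.
have c't x : x \in ~: P -> c' x < t by rewrite /c'; case: ifP => // /ct.
have [turan_ge _] := part_prod_leq_turan (isT : 0 < t) c't.
have cP : #|~: P| = n - 2 by have := cardsC P; rewrite P2 -/n; lia.
rewrite cP in turan_ge.
(* Each vertex of Y put into colour class 0 gains at least p / n transversals. *)
have gain : (n + #|Y|) * p <= n * part_prod c' t (~: P).
  pose q := \prod_(i < t.-1) #|part c X (lift ord0 i)|.
  have pE : p = #|part c X 0| * q by rewrite /p /part_prod big_ord_recl.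
  have -> : part_prod c' t (~: P) = (#|part c X 0| + #|Y|) * q.
    have YX y : y \in Y -> y \notin X by rewrite in_setC in_setU negb_or => /andP[].
    rewrite /part_prod big_ord_recl; congr (_ * _).
      have -> : part c' (~: P) 0 = part c X 0 :|: Y.
        apply/setP => x; rewrite in_setU [x \in part c' _ _]in_set.
        rewrite [x \in part c _ _]in_set in_setC [x \in Y]in_setC in_setU negb_or /c'.
        case: (boolP (x \in X)) => xX; last by rewrite /= andbT.
        by have := disjointFl PX xX; rewrite andbF orbF => ->.
      rewrite cardsU (_ : _ :&: Y = set0) ?cards0 ?subn0 //.
      apply/setP => x; rewrite in_setI in_set in_set0.
      by case: (boolP (x \in Y)) => [/YX/negPf ->|]; rewrite ?andbF.
    apply: eq_bigr => i _; apply: eq_card => x.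
    rewrite [x \in part c' _ _]in_set [x \in part c _ _]in_set in_setC /c'.
    by case: (boolP (x \in X)) => xX; rewrite ?andbF // (disjointFl PX xX).
  have a0n : #|part c X 0| <= n by apply: max_card.
  rewrite pE mulnA mulnDl !mulnA mulnDr !mulnDl leq_add2l leq_mul2r mulnC.
  by rewrite leq_mul2r a0n !orbT.
pose E' := E + 2 ^ gap; set y := #|Y| in Y_gt0 Yg gain K_le.
have K_le' : #|K| <= p + y * E'.
  apply: leq_trans K_le _; apply: leq_add => //.
  rewrite /E' mulnDr leq_add2l; apply: leq_trans (leq_pmull _ Y_gt0).
  by rewrite leq_exp2l.
have p_le : p <= n * E'.
  have : (n + y) * p <= n * (p + y * E').
    apply: leq_trans gain _; rewrite leq_mul2l (leq_trans turan_ge) ?orbT //.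
    exact: leq_trans K_large K_le'.
  by rewrite mulnDl mulnDr leq_add2l mulnCA leq_pmul2l.
have E'_le : E' <= (r + 2 ^ gap) * n ^ s.+1.
  by rewrite mulnDl leq_add2l leq_pmulr // expn_gt0 n0.
have K_small : #|K| <= large_const * n ^ s.+2.
  apply: leq_trans K_le' _; apply: (@leq_trans (2 * (n * E'))).
    rewrite mul2n -addnn leq_add // leq_mul2r (leq_trans Yg) ?orbT //.
    exact: ltnW.
  by rewrite /large_const -mulnA leq_mul2l /= [n ^ s.+2]expnS mulnCA leq_mul2l E'_le orbT.
have : n * n ^ s.+2 <= (t ^ t * large_const + t * t.+2) * n ^ s.+2.
  rewrite -expnS; apply: leq_trans expn_card_K _.
  by rewrite mulnDl leq_add2r mulnC -mulnA leq_mul2l K_small orbT.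
by rewrite leq_pmul2r ?expn_gt0 ?n0 // leqNgt ln.
Qed.

End Structure.

(** * The extremal graph *)

Lemma multipartite_join_iso (V : finType) (G : sgraph V) (c : V -> nat) t m p q :
    p != q -> adj G p q ->
    (forall x y, x \in [set p; q] -> y \notin [set p; q] -> adj G x y) ->
    #|~: [set p; q]| = m ->
    (forall x, x \in ~: [set p; q] -> c x < t) ->
    multipartite G c (~: [set p; q]) -> balanced c t (~: [set p; q]) ->
  isomorphic G (join (complete 2) (turan t m)).
Proof.
move=> pq pq_adj adjPW Wm ct mW bal; set W := ~: _ in Wm ct mW bal.
have [f [s [ps finj fm fs]]] := balanced_numbering ct bal; rewrite Wm in fm.
(* On W the values of f are below m, so [insub] succeeds there; q is sent to [ord_max] whatever f
   does at q. *)
pose g x : ('I_2 + 'I_m)%type := if x == p then inl ord0 else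
  if insub (f x) is Some i then if x == q then inl ord_max else inr i else inl ord_max.
have gp : g p = inl ord0 by rewrite /g eqxx.
have gq : g q = inl ord_max by rewrite /g eq_sym (negPf pq) eqxx; case: insub.
have gW x (xW : x \in W) : g x = inr (Ordinal (fm x xW)).
  have /andP[/negPf xp /negPf xq] : (x != p) && (x != q).
    by rewrite -negb_or -in_set2 -in_setC.
  by rewrite /g xp xq (insubT (fun i => i < m) (fm x xW)).
have VW x : [\/ x = p, x = q | x \in W].
  rewrite in_setC in_set2; case: (x =P p) => [->|_]; first by constructor 1.
  by case: (x =P q) => [->|_]; [constructor 2|constructor 3].
have us : uniq s by rewrite (perm_uniq ps) iota_uniq.
have cs x : x \in W -> c x \in s by move=> /ct; rewrite (perm_mem ps) mem_iota.
have ginj : injective g.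
  move=> x y; case: (VW x) => [->|->|xW]; case: (VW y) => [->|->|yW] //;
    rewrite ?gp ?gq ?gW //.
  by case=> /finj; apply.
have cV : #|V| = m.+2 by rewrite -(cardsC [set p; q]) cards2 pq Wm.
exists g; first by apply: inj_card_bij; rewrite // card_sum !card_ord cV.
have p2 : p \in [set p; q] by rewrite set21.
have q2 : q \in [set p; q] by rewrite set22.
have nW x : x \in W -> x \notin [set p; q] by rewrite in_setC.
move=> x y; case: (VW x) => [->|->|xW]; case: (VW y) => [->|->|yW];
  rewrite ?gp ?gq ?gW adj_join ?adj_complete ?adj_irr ?pq_adj //.
- by rewrite adjPW // nW.
- by rewrite adjC pq_adj.
- by rewrite adjPW // nW.
- by rewrite adjC adjPW // nW.
- by rewrite adjC adjPW // nW.
rewrite adj_turan /= !fs // mW //; congr (~~ _).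
apply/eqP/eqP => [eqi|-> //].
by rewrite -[c x](nth_index 0 (cs x xW)) eqi nth_index ?cs.
Qed.

Definition threshold s :=
  (gap s + s.+3 ^ s.+3 * large_const s + s.+3 * s.+3.+2).+1.

(** Once [ext P] is the complement of P, every r-clique is a page, so |K| is bounded by the
    t-cliques outside P, these by a product of colour classes, and that by the Turan product. The
    hypothesis closes the chain, so all equality cases hold at once. *)
Lemma extremal_structure s (V : finType) (G : sgraph V) :
    avoids_one G s.+3.+2 -> threshold s <= #|V| ->
    turan_prod s.+3 (#|V| - 2) <= #|cliques G s.+3.+2 setT| ->
  isomorphic G (join (complete 2) (turan s.+3 (#|V| - 2))).
Proof.
move=> avG large Klarge; have gn : gap s < #|V| by rewrite /threshold in large; lia.
have ln : s.+3 ^ s.+3 * large_const s + s.+3 * s.+3.+2 < #|V|.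
  by rewrite /threshold in large; lia.
have [P PH extP] := spanning_ext avG Klarge gn ln.
have /andP[hP /cards2P[p [q [pq Ppq]]]] : heavy s.+3.+2 (cliques G s.+3.+2 setT) P && (#|P| == 2).
  by rewrite inE in PH.
have P2 : #|P| = 2 by rewrite Ppq cards2 pq.
have cW : #|~: P| = #|V| - 2 by have := cardsC P; rewrite P2; lia.
have Kpages : #|cliques G s.+3.+2 setT| <= #|cliques G s.+3 (~: P)|.
  rewrite -extP; apply: leq_trans (card_pages_leq PH);
    apply/subset_leq_card/subsetP => B BK.
  have /card_gt0P[x xB] : 0 < #|B| by rewrite (K_card BK).
  have PB : P \subset B by apply: (pair_subset avG PH BK _ xB);
    rewrite extP setUCr in_setT.
  rewrite in_set BK PB extP; apply/subsetP => y /setDP[_ yP].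
  by rewrite in_setC.
have no := ext_cliques0 avG PH; rewrite extP in no.
have [c [ct cle ceq]] := card_cliques_leq_prod no.
have [prod_le bal] := part_prod_leq_turan (isT : 0 < s.+3) ct;
  rewrite cW in prod_le bal.
have eqK : #|cliques G s.+3 (~: P)| = part_prod c s.+3 (~: P).
  by apply/eqP; rewrite eqn_leq cle (leq_trans prod_le) // (leq_trans Klarge).
have eqT : part_prod c s.+3 (~: P) = turan_prod s.+3 (#|V| - 2).
  by apply/eqP; rewrite eqn_leq prod_le -eqK (leq_trans Klarge).
have T_gt0 : 0 < turan_prod s.+3 (#|V| - 2).
  apply: leq_trans (turan_prod_geq _ _); rewrite expn_gt0 divn_gt0 //.
  have : 1 * s.+3.+2 <= s.+3 * s.+3.+2 by rewrite leq_mul2r orbT.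
  by rewrite mul1n; lia.
have mW := ceq eqK; rewrite eqK eqT in mW; have {}bal := bal eqT; rewrite eqT in bal.
have adjPW x y : x \in P -> y \notin P -> adj G x y.
  by move=> xP yP; apply: (@ext_adj s _ G P) => //; rewrite extP in_setC.
apply: (@multipartite_join_iso _ G c _ _ p q) => //; rewrite -?Ppq //.
- by apply: (cliqueP _ _ (heavy_clique hP)); rewrite // Ppq !inE eqxx ?orbT.
- exact: mW.
- exact: bal.
Qed.

Theorem theorem1p4 (r : nat) (hr : 5 <= r) :
  exists n0 : nat, forall n : nat, n0 <= n ->
    [/\ ex n (complete r) (two_cliques r 1)
          = ncopies (complete (r - 2)) (turan (r - 2) (n - 2)),
        extremal n (complete r) (two_cliques r 1)
          (join (complete 2) (turan (r - 2) (n - 2)))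
      & forall (V : finType) (G : sgraph V),
          extremal n (complete r) (two_cliques r 1) G ->
          isomorphic G (join (complete 2) (turan (r - 2) (n - 2)))].
Proof.
have [s -> {r hr}] : exists s, r = s.+3.+2 by exists (r - 5); lia.
exists (threshold s) => n large.
have n2 : 2 <= n by rewrite (leq_trans _ large) // /threshold ltnS addnC addSn.
rewrite (_ : s.+3.+2 - 2 = s.+3) //.
set T := turan s.+3 (n - 2); set J := join (complete 2) T.
have cJ : #|{: 'I_2 + 'I_(n - 2)}| = n by rewrite card_sum !card_ord subnKC.
have avJ : avoids_one J s.+3.+2 by apply: join_avoids_one.
have KJ : #|cliques J s.+3.+2 setT| = ncopies (complete s.+3) T.
  by rewrite ncopies_complete card_cliques_join.
have TE : ncopies (complete s.+3) T = turan_prod s.+3 (n - 2).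
  by rewrite ncopies_complete card_cliques_turan.
have iso (V : finType) (G : sgraph V) : #|V| = n -> avoids_one G s.+3.+2 ->
    ncopies (complete s.+3) T <= #|cliques G s.+3.+2 setT| -> isomorphic G J.
  by move=> cV avG; have := extremal_structure avG; rewrite cV TE; apply.
have exE : ex n (complete s.+3.+2) (two_cliques s.+3.+2 1) = ncopies (complete s.+3) T.
  apply/eqP; rewrite eqn_leq; apply/andP; split.
    apply/bigmax_leqP => G /(free_two_cliquesP G (isT : 0 < s.+3.+2)) avG.
    (* A graph with more cliques would still be isomorphic to J, hence have equally many. *)
    rewrite ncopies_complete leqNgt; apply/negP => lt.
    have /isomorphic_cliques eqc := iso _ G (card_ord n) avG (ltnW lt).
    by rewrite (eqc s.+3.+2) KJ ltnn in lt.
  (* [ex] ranges over graphs on ['I_n], so J is relabelled. *)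
  have [H isoH] := isomorphic_ord J cJ.
  rewrite -KJ (isomorphic_cliques _ isoH) -ncopies_complete.
  apply: (@leq_bigmax_cond (sgraph 'I_n) (free (two_cliques s.+3.+2 1))
    (ncopies (complete s.+3.+2)) H).
  by apply/free_two_cliquesP => //; apply: isomorphic_avoids_one isoH avJ.
split=> //.
  split=> //; first exact/free_two_cliquesP.
  by rewrite exE ncopies_complete.
move=> V G [cV /(free_two_cliquesP G (isT : 0 < s.+3.+2)) avG Gex].
by apply: iso => //; rewrite -ncopies_complete Gex exE.
Qed.
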